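(* Let $K$ be a field and let $\Lambda$ be the Brauer configuration algebra associated to a reduced Brauer configuration $\Gamma$. Let $P=e_v\Lambda$ be an indecomposable projective $\Lambda$-module associated to a $d$-gon $V$ of $\Gamma$. Put $r=d$ if all vertices of $V$ are nontruncated, and $r=1$ if $V$ is a $2$-gon with one truncated vertex. Then $\mathrm{rad}(P)$ is the sum of the $r$ uniserial $\Lambda$-modules $\sum_CU_1(C)$, where $C$ runs over the special $\alpha$-cycles at $v$ for every nontruncated vertex $\alpha$ of $V$. If $r>1$, then for any two distinct such special cycles $C\neq C'$ at $v$, the intersection $U_1(C)\cap U_1(C')$ is the simple socle of $P$. Furthermore, the heart $\mathrm{rad}(P)/\mathrm{soc}(P)$ of $P$ is a direct sum of uniserial $\Lambda$-modules.
   Context: Modules are right modules. For a polygon $V$, $v$ denotes the associated vertex of the quiver and $e_v$ the corresponding primitive idempotent of $\Lambda$. For a special $\alpha$-cycle $C$ at $v$, $U_1(C)$ is the submodule of $e_v\Lambda$ generated by the image of the first arrow of $C$; it has as $K$-basis the images in $\Lambda$ of the prefixes of length $\ge1$ of $C^{\mu(\alpha)}$. Brauer configuration. A Brauer configuration $\Gamma=(\Gamma_0,\Gamma_1,\mu,\mathfrak o)$ consists of a finite set $\Gamma_0$ of vertices, a finite collection $\Gamma_1$ of labelled finite multisets of elements of $\Gamma_0$, called polygons (differently labelled polygons may be equal as multisets; a $d$-gon is a polygon with $d$ elements counted with multiplicity), a multiplicity function $\mu\colon\Gamma_0\to\mathbb Z_{>0}$, and an orientation $\mathfrak o$. For $\alpha\in\Gamma_0$,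 $V\in\Gamma_1$, $\mathrm{occ}(\alpha,V)$ is the number of times $\alpha$ occurs in $V$, and $\mathrm{val}(\alpha)=\sum_{V\in\Gamma_1}\mathrm{occ}(\alpha,V)$. An orientation is a choice, for each $\alpha\in\Gamma_0$, of a cyclic ordering of the list of polygons containing $\alpha$, where each $V$ is listed $\mathrm{occ}(\alpha,V)$ times (the different occurrences being distinguished). It is required that: every vertex lies in at least one polygon; every polygon has at least two vertices (counted with multiplicity); every polygon contains a vertex $\alpha$ with $\mathrm{val}(\alpha)\mu(\alpha)>1$. A vertex $\alpha$ is truncated if $\mathrm{val}(\alpha)\mu(\alpha)=1$, and nontruncated otherwise. $\Gamma$ is reduced if every polygon either contains no truncated vertex or is a $2$-gon with exactly one truncated vertex. Quiver. $\mathcal Q_\Gamma$ has one vertex $v$ for each polygon $V\in\Gamma_1$. For a nontruncated $\alpha$, the cyclically ordered list $V_1<\dots<V_t$ ($t=\mathrm{val}(\alpha)$, $V_{t+1}=V_1$) given by $\mathfrak o$ is the successor sequence at $\alpha$; for each $r=1,\dots,t$ there is an arrow $a_r$ from the vertex $v_r$ associated to $V_r$ to the vertex $v_{r+1}$ associated to $V_{r+1}$ (a loop if $t=1$). The arrows obtained for different $\alpha$ and different $r$ are distinct, and these are all arrows of $\mathcal Q_\Gamma$. Paths are written from left to right. Special cycles. With this notation put $C_j=a_ja_{j+1}\cdots a_ta_1\cdots a_{j-1}$. If $V$ is a polygon containing $\alpha$, the special $\alpha$-cycles at $v$ are the $C_j$ with $V_j=V$ (so there are $\mathrm{occ}(\alpha,V)$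 of them). Algebra. $\Lambda_\Gamma=K\mathcal Q_\Gamma/I_\Gamma$, where $I_\Gamma$ is generated by: (type one) all $C^{\mu(\alpha)}-(C')^{\mu(\beta)}$ where, for some polygon $V$, $C$ is a special $\alpha$-cycle at $v$ and $C'$ is a special $\beta$-cycle at $v$, with $\alpha,\beta$ nontruncated vertices of $V$ (possibly $\alpha=\beta$); (type two) all $C^{\mu(\alpha)}a$ where $C$ is a special $\alpha$-cycle and $a$ is the first arrow of $C$; (type three) all paths $ab$ of length two that are not a subpath of any special cycle, except those with $a=b$ a loop associated to a vertex $\alpha$ with $\mathrm{val}(\alpha)=1$ and $\mu(\alpha)>1$. *)

(* Defs.v *)
From HB Require Import structures.
From mathcomp Require Import all_boot perm all_algebra.
From mathcomp Require Import finmap multiset monalg.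
From mathcomp Require Import boolp classical_sets.

Set Implicit Arguments.
Unset Strict Implicit.
Unset Printing Implicit Defensive.

Import GRing.Theory.
Local Open Scope ring_scope.
Local Open Scope classical_set_scope.
Local Open Scope quotient_scope.

(** MathComp quotients are taken by boolean predicates and its quotient rings are
    commutative; the quotient of a module by a submodule and of a ring by a
    two-sided ideal are built here, with membership in a [set] decided
    classically. *)

Definition subgroup (V : zmodType) (N : set V) : Prop :=
  N 0 /\ forall x y, N x -> N y -> N (x - y).

Definition subgroup_pred (V : zmodType) (N : set V) of subgroup N : {pred V} :=
  fun x => `[< N x >].

Lemma subgroup_pred_closed (V : zmodType) (N : set V) (hN : subgroup N) :
  zmod_closed (subgroup_pred hN).
Proof.
case: (hN) => N0 NB; split; first exact/asboolP.
by move=> x y /asboolP Nx /asboolP Ny; apply/asboolP/NB.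
Qed.

HB.instance Definition _ (V : zmodType) (N : set V) (hN : subgroup N) :=
  GRing.isZmodClosed.Build V (subgroup_pred hN) (subgroup_pred_closed hN).

Definition quot_group (V : zmodType) (N : set V) (hN : subgroup N) : zmodType :=
  Quotient.quot (subgroup_pred hN).

Definition quot_class (V : zmodType) (N : set V) (hN : subgroup N) (x : V) :
  quot_group hN := \pi_(Quotient.quot (subgroup_pred hN)) x.

Section QuotGroup.
Variables (V : zmodType) (N : set V) (hN : subgroup N).
Local Notation "[ x ]" := (quot_class hN x).

Lemma quot_class_eq x y : [x] = [y] <-> N (x - y).
Proof.
have := Quotient.idealrBE (subgroup_pred hN) x y.
rewrite unfold_in /= => e; split=> [h|h].
  by apply/asboolP; rewrite /= e; apply/eqP.
by apply/eqP; rewrite -e; apply/asboolP.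
Qed.

Lemma quot_classD x y : [x + y] = [x] + [y].
Proof. exact: (@raddfD _ _ \pi_(Quotient.quot (subgroup_pred hN))). Qed.

Lemma quot_classK (u : quot_group hN) : [repr u] = u.
Proof. exact: reprK. Qed.

Lemma quot_class_surj (u : quot_group hN) : exists x, [x] = u.
Proof. by exists (repr u); rewrite quot_classK. Qed.

End QuotGroup.

Definition submodule (R : pzRingType) (M : lmodType R) (N : set M) : Prop :=
  N 0 /\ forall (a : R) x y, N x -> N y -> N (a *: x + y).

Lemma submodule_subgroup (R : pzRingType) (M : lmodType R) (N : set M) :
  submodule N -> subgroup N.
Proof.
by case=> N0 NZ; split=> // x y Nx Ny; rewrite addrC -scaleN1r; apply: NZ.
Qed.

Definition quot_module (R : pzRingType) (M : lmodType R) (N : set M)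
  (hN : submodule N) : Type := quot_group (submodule_subgroup hN).

Definition quot_module_class (R : pzRingType) (M : lmodType R) (N : set M)
  (hN : submodule N) : M -> quot_module hN :=
  quot_class (submodule_subgroup hN).

Section QuotModule.
Variables (R : pzRingType) (M : lmodType R) (N : set M) (hN : submodule N).

HB.instance Definition _ := GRing.Zmodule.on (quot_module hN).

Local Notation "[ x ]" := (quot_module_class hN x).

Definition quot_module_scale (a : R) (u : quot_module hN) : quot_module hN :=
  [a *: repr u].

Lemma quot_module_scaleE a x : quot_module_scale a [x] = [a *: x].
Proof.
apply/quot_class_eq; rewrite -scalerBr -[X in N X]addr0; apply: (hN.2) hN.1.
by apply/(quot_class_eq (submodule_subgroup hN)); rewrite quot_classK.
Qed.

Lemma quot_module_classD x y : [x + y] = [x] + [y].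
Proof. exact: quot_classD. Qed.

Lemma quot_module_class_surj (u : quot_module hN) : exists x, [x] = u.
Proof. exact: quot_class_surj. Qed.

Lemma quot_module_scaleA a b u :
  quot_module_scale a (quot_module_scale b u) = quot_module_scale (a * b) u.
Proof.
have [x <-] := quot_module_class_surj u.
by rewrite !quot_module_scaleE scalerA.
Qed.

Lemma quot_module_scale1 : left_id 1 quot_module_scale.
Proof.
move=> u; have [x <-] := quot_module_class_surj u.
by rewrite quot_module_scaleE scale1r.
Qed.

Lemma quot_module_scaleDr : right_distributive quot_module_scale +%R.
Proof.
move=> a u v; have [x <-] := quot_module_class_surj u.
have [y <-] := quot_module_class_surj v.
by rewrite -quot_module_classD !quot_module_scaleE scalerDr quot_module_classD.
Qed.

Lemma quot_module_scaleDl u : {morph quot_module_scale^~ u : a b / a + b}.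
Proof.
move=> a b; have [x <-] := quot_module_class_surj u.
by rewrite !quot_module_scaleE scalerDl quot_module_classD.
Qed.

HB.instance Definition _ := GRing.Zmodule_isLmodule.Build R (quot_module hN)
  quot_module_scaleA quot_module_scale1 quot_module_scaleDr quot_module_scaleDl.

End QuotModule.

Definition two_sided_ideal (R : pzRingType) (I : set R) : Prop :=
  [/\ subgroup I, forall a x, I x -> I (a * x) & forall a x, I x -> I (x * a)].

Lemma two_sided_ideal_subgroup (R : pzRingType) (I : set R) :
  two_sided_ideal I -> subgroup I.
Proof. by case. Qed.

Definition quot_ring (R : pzRingType) (I : set R) (hI : two_sided_ideal I) :
  Type := quot_group (two_sided_ideal_subgroup hI).

Definition quot_ring_class (R : pzRingType) (I : set R)
  (hI : two_sided_ideal I) : R -> quot_ring hI :=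
  quot_class (two_sided_ideal_subgroup hI).

Section QuotRing.
Variables (R : pzRingType) (I : set R) (hI : two_sided_ideal I).

HB.instance Definition _ := GRing.Zmodule.on (quot_ring hI).

Local Notation "[ x ]" := (quot_ring_class hI x).

Definition quot_ring_one : quot_ring hI := [1].
Definition quot_ring_mul (u v : quot_ring hI) : quot_ring hI :=
  [repr u * repr v].

Lemma quot_ring_mulE x y : quot_ring_mul [x] [y] = [x * y].
Proof.
have [hIg IMl IMr] := hI.
have Ir z : I (repr [z] - z).
  by apply/(quot_class_eq (two_sided_ideal_subgroup hI)); rewrite quot_classK.
apply/quot_class_eq.
have -> : repr [x] * repr [y] - x * y =
    (repr [x] - x) * repr [y] - x * - (repr [y] - y).
  by rewrite mulrN opprK mulrBl mulrBr addrA subrK.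
by apply: hIg.2; [exact: IMr | rewrite mulrN -mulNr; exact: IMl].
Qed.

Lemma quot_ring_classD x y : [x + y] = [x] + [y].
Proof. exact: quot_classD. Qed.

Lemma quot_ring_class_surj (u : quot_ring hI) : exists x, [x] = u.
Proof. exact: quot_class_surj. Qed.

Lemma quot_ring_mulA : associative quot_ring_mul.
Proof.
move=> u v w; have [x <-] := quot_ring_class_surj u.
have [y <-] := quot_ring_class_surj v; have [z <-] := quot_ring_class_surj w.
by rewrite !quot_ring_mulE mulrA.
Qed.

Lemma quot_ring_mul1l : left_id quot_ring_one quot_ring_mul.
Proof.
by move=> u; have [x <-] := quot_ring_class_surj u; rewrite quot_ring_mulE mul1r.
Qed.

Lemma quot_ring_mul1r : right_id quot_ring_one quot_ring_mul.
Proof.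
by move=> u; have [x <-] := quot_ring_class_surj u; rewrite quot_ring_mulE mulr1.
Qed.

Lemma quot_ring_mulDl : left_distributive quot_ring_mul +%R.
Proof.
move=> u v w; have [x <-] := quot_ring_class_surj u.
have [y <-] := quot_ring_class_surj v; have [z <-] := quot_ring_class_surj w.
by rewrite -quot_ring_classD !quot_ring_mulE mulrDl quot_ring_classD.
Qed.

Lemma quot_ring_mulDr : right_distributive quot_ring_mul +%R.
Proof.
move=> u v w; have [x <-] := quot_ring_class_surj u.
have [y <-] := quot_ring_class_surj v; have [z <-] := quot_ring_class_surj w.
by rewrite -quot_ring_classD !quot_ring_mulE mulrDr quot_ring_classD.
Qed.

HB.instance Definition _ := GRing.Zmodule_isPzRing.Build (quot_ring hI)
  quot_ring_mulA quot_ring_mul1l quot_ring_mul1r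
  quot_ring_mulDl quot_ring_mulDr.

Lemma quot_ring_classM x y : [x * y] = [x] * [y].
Proof. by rewrite -quot_ring_mulE. Qed.

Lemma quot_ring_class_eq x y : [x] = [y] <-> I (x - y).
Proof. exact: quot_class_eq. Qed.

End QuotRing.

Definition ideal_generated (R : pzRingType) (S : set R) : set R :=
  smallest (@two_sided_ideal R) S.

Lemma ideal_generated_ideal (R : pzRingType) (S : set R) :
  two_sided_ideal (ideal_generated S).
Proof.
split; first split.
- by move=> J [[[]]].
- by move=> x y Ix Iy J hJ; have [[[_ JB] _ _] _] := hJ; apply: JB;
    [exact: Ix | exact: Iy].
- by move=> a x Ix J hJ; have [[_ JM _] _] := hJ; apply: JM; exact: Ix.
- by move=> a x Ix J hJ; have [[_ _ JM] _] := hJ; apply: JM; exact: Ix.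
Qed.

(** Everything is stated for submodules, given as subsets, of an ambient module:
    the submodules of a submodule [P] are the submodules contained in [P], and
    [P / N] is the image of [P] in the quotient of the ambient module by [N]. *)

Section Modules.
Variables (R : pzRingType) (M : lmodType R).
Implicit Types (N P S : set M).

Definition submodule_generated (A : set M) : set M := smallest (@submodule R M) A.

Definition sum_submodules (F : set (set M)) : set M :=
  submodule_generated (\bigcup_(N in F) N).

Definition simple_submodule S : Prop :=
  [/\ submodule S, S <> [set 0] &
      forall N, submodule N -> N `<=` S -> N = [set 0] \/ N = S].

Definition maximal_submodule P N : Prop :=
  [/\ submodule N, N `<` P &
      forall L, submodule L -> N `<=` L -> L `<=` P -> L = N \/ L = P].

Definition radical P : set M :=
  P `&` \bigcap_(N in [set N | maximal_submodule P N]) N.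

Definition socle P : set M :=
  sum_submodules [set S | simple_submodule S /\ S `<=` P].

Definition uniserial N : Prop :=
  submodule N /\
  forall A B, submodule A -> submodule B -> A `<=` N -> B `<=` N ->
    A `<=` B \/ B `<=` A.

Definition direct_sum (n : nat) (U : 'I_n -> set M) P : Prop :=
  [/\ forall i, submodule (U i),
      P = [set \sum_(i < n) u i | u in [set u : 'I_n -> M | forall i, U i (u i)]] &
      forall u : 'I_n -> M, (forall i, U i (u i)) ->
        \sum_(i < n) u i = 0 -> forall i, u i = 0].

Lemma submodule_generated_submodule (A : set M) :
  submodule (submodule_generated A).
Proof.
split; first by move=> N [[]].
by move=> a x y Ax Ay N hN; have [[_ NZ] _] := hN; apply: NZ;
  [exact: Ax | exact: Ay].
Qed.

Lemma socle_submodule P : submodule (socle P).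
Proof. exact: submodule_generated_submodule. Qed.

Definition heart P : set (quot_module (socle_submodule P)) :=
  quot_module_class (socle_submodule P) @` radical P.

End Modules.

Arguments heart {R M} P.

Record quiver := Quiver {
  quiver_vertex : finType;
  quiver_arrow : finType;
  source : quiver_arrow -> quiver_vertex;
  target : quiver_arrow -> quiver_vertex
}.

Fixpoint is_path (Q : quiver) (v : quiver_vertex Q) (s : seq (quiver_arrow Q)) :
  bool := if s is a :: s' then (source a == v) && is_path (target a) s' else true.

(** A path is given by its starting vertex and its arrows, from left to right;
    the starting vertex is what tells the trivial paths apart. *)
Definition qpath (Q : quiver) : choiceType :=
  {p : quiver_vertex Q * seq (quiver_arrow Q) | is_path p.1 p.2}.

Definition mk_path (Q : quiver) (v : quiver_vertex Q)
  (s : seq (quiver_arrow Q)) (vs : is_path v s) : qpath Q :=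
  exist (fun w => is_path w.1 w.2) (v, s) vs.

Section Paths.
Variable Q : quiver.
Implicit Types (v : quiver_vertex Q) (a : quiver_arrow Q) (p q : qpath Q).

Definition path_start p : quiver_vertex Q := (val p).1.
Definition path_arrows p : seq (quiver_arrow Q) := (val p).2.
Definition path_end p : quiver_vertex Q :=
  last (path_start p) (map (@target Q) (path_arrows p)).

Definition trivial_path v : qpath Q :=
  @mk_path Q v [::] isT.

Lemma arrow_path_subproof a : is_path (source a) [:: a].
Proof. by rewrite /= eqxx. Qed.

Definition arrow_path a : qpath Q :=
  mk_path (arrow_path_subproof a).

Lemma is_path_cat v (s t : seq (quiver_arrow Q)) :
  is_path v (s ++ t) = is_path v s && is_path (last v (map (@target Q) s)) t.
Proof. by elim: s v => //= a s IH v; rewrite IH andbA. Qed.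

Lemma path_prefix_subproof k p : is_path (path_start p) (take k (path_arrows p)).
Proof.
have := valP p; rewrite -{1}(cat_take_drop k (val p).2) is_path_cat.
by case/andP.
Qed.

Definition path_prefix k p : qpath Q :=
  mk_path (path_prefix_subproof k p).

Definition path_concat p q : option (qpath Q) :=
  if path_end p == path_start q
  then insub (path_start p, path_arrows p ++ path_arrows q) else None.

Variant path_concat_spec p q : option (qpath Q) -> Type :=
| PathConcatSome r of path_end p = path_start q & path_start r = path_start p
    & path_end r = path_end q & path_arrows r = path_arrows p ++ path_arrows q :
    path_concat_spec p q (Some r)
| PathConcatNone of path_end p != path_start q : path_concat_spec p q None.

Lemma path_concatP p q : path_concat_spec p q (path_concat p q).
Proof.
rewrite /path_concat; case: eqP => [e|/eqP e]; last exact: PathConcatNone.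
case: insubP => [r _ er|]; last first.
  rewrite /= is_path_cat -/(path_end p) e.
  by rewrite (valP p : is_path (path_start p) _) (valP q : is_path (path_start q) _).
apply: PathConcatSome => //; rewrite ?/path_end ?/path_start ?/path_arrows er //=.
by rewrite map_cat last_cat -/(path_arrows p) -/(path_start p) -/(path_end p) e.
Qed.

Lemma qpath_eq p q :
  path_start p = path_start q -> path_arrows p = path_arrows q -> p = q.
Proof.
rewrite /path_start /path_arrows => es ea; apply: val_inj.
by rewrite (surjective_pairing (val p)) es ea -surjective_pairing.
Qed.

End Paths.

Definition path_algebra (K : fieldType) (Q : quiver) : Type :=
  {malg K[qpath Q]}.

HB.instance Definition _ (K : fieldType) (Q : quiver) :=
  GRing.Zmodule.on (path_algebra K Q).

(** Scaling and multiplication are locked because unfolding them in a failing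
    unification does not terminate in practice. *)
HB.lock Definition path_scale (K : fieldType) (Q : quiver) (c : K)
  (f : path_algebra K Q) : path_algebra K Q := c *: (f : {malg K[qpath Q]}).

Section PathModule.
Variables (K : fieldType) (Q : quiver).
Local Notation A := (path_algebra K Q).

Lemma path_scaleE (c : K) (f : A) (p : qpath Q) :
  (path_scale c f)@_p = c * f@_p.
Proof. by rewrite path_scale.unlock mcoeffZ. Qed.

Lemma path_scaleA (c d : K) (f : A) :
  path_scale c (path_scale d f) = path_scale (c * d) f.
Proof. by rewrite !path_scale.unlock scalerA. Qed.

Lemma path_scale1 : left_id 1 (@path_scale K Q).
Proof. by move=> f; rewrite path_scale.unlock scale1r. Qed.

Lemma path_scaleDr : right_distributive (@path_scale K Q) +%R.
Proof. by move=> c f g; rewrite !path_scale.unlock scalerDr. Qed.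

Lemma path_scaleDl (f : A) : {morph (@path_scale K Q)^~ f : c d / c + d}.
Proof. by move=> c d; rewrite !path_scale.unlock scalerDl. Qed.

HB.instance Definition _ := GRing.Zmodule_isLmodule.Build K A
  path_scaleA path_scale1 path_scaleDr path_scaleDl.

Lemma path_coeffZ (c : K) (f : A) (p : qpath Q) : (c *: f)@_p = c * f@_p.
Proof. exact: path_scaleE. Qed.

End PathModule.

HB.lock Definition path_elt (K : fieldType) (Q : quiver) (p : qpath Q) :
  path_algebra K Q := << p >>.

Definition path_concat_elt (K : fieldType) (Q : quiver) (p q : qpath Q) :
  path_algebra K Q :=
  if path_concat p q is Some r then path_elt K r else 0.

HB.lock Definition path_mul (K : fieldType) (Q : quiver)
  (f g : path_algebra K Q) : path_algebra K Q :=
  \sum_(p <- msupp f) \sum_(q <- msupp g)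
    (f@_p * g@_q) *: path_concat_elt K p q.

Section PathAlgebra.
Variables (K : fieldType) (Q : quiver).
Local Notation A := (path_algebra K Q).
Local Notation path_mul := (@path_mul K Q).
Implicit Types (f g h : A) (p q r : qpath Q).

Definition path_one : A :=
  \sum_(v : quiver_vertex Q) path_elt K (trivial_path v).

Let lift (F : qpath Q -> A) f : A := \sum_(p <- msupp f) f@_p *: F p.

Let liftE F f (d : {fset qpath Q}) : (msupp f `<=` d)%fset ->
  lift F f = \sum_(p <- d) f@_p *: F p.
Proof.
move=> sfd; apply: big_fset_incl => // p _ pNf.
by rewrite mcoeff_outdom ?scale0r.
Qed.

Let liftD F f g : lift F (f + g) = lift F f + lift F g.
Proof.
rewrite (@liftE F f (msupp f `|` msupp g)%fset) ?fsubsetUl //.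
rewrite (@liftE F g (msupp f `|` msupp g)%fset) ?fsubsetUr //.
rewrite (@liftE F (f + g) (msupp f `|` msupp g)%fset) ?msuppD_le //.
by rewrite -big_split; apply: eq_bigr => p _; rewrite mcoeffD scalerDl.
Qed.

Let liftZ F (c : K) f : lift F (c *: f) = c *: lift F f.
Proof.
rewrite (@liftE F (c *: f) (msupp f)) => [|]; last first.
  apply/fsubsetP=> p; rewrite -!mcoeff_neq0 path_coeffZ.
  by apply: contraTneq => ->; rewrite mulr0 eqxx.
rewrite scaler_sumr.
by apply: eq_bigr => p _; rewrite path_coeffZ scalerA.
Qed.

Let liftU F p : lift F (path_elt K p) = F p.
Proof.
rewrite path_elt.unlock (@liftE F _ [fset p]%fset) ?msuppU_le // big_seq_fset1.
by rewrite mcoeffUU scale1r.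
Qed.

Let lift_mul f g : path_mul f g = lift (fun p => lift (path_concat_elt K p) g) f.
Proof.
rewrite path_mul.unlock; apply: eq_bigr => p _; rewrite scaler_sumr.
by apply: eq_bigr => q _; rewrite scalerA.
Qed.

Lemma path_algebra_ind (T : A -> Prop) : T 0 ->
  (forall f g, T f -> T g -> T (f + g)) -> (forall c f, T f -> T (c *: f)) ->
  (forall p, T (path_elt K p)) -> forall f, T f.
Proof.
move=> T0 TD TZ TU f; have eU c p : << c *g p >> = c *: path_elt K p.
  apply/malgP => q; rewrite path_coeffZ path_elt.unlock.
  apply: etrans (mcoeffU p c q) _; apply/esym.
  by apply: etrans (congr1 ( *%R c) (mcoeffU p 1 q)) _; rewrite mulrnAr mulr1.
rewrite [f]monalgE; apply: (big_ind T) => // p _.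
by rewrite eU; exact/TZ/TU.
Qed.

Lemma path_mulDl : left_distributive path_mul +%R.
Proof. by move=> f g h; rewrite !lift_mul liftD. Qed.

Lemma path_mulZl c f g : path_mul (c *: f) g = c *: path_mul f g.
Proof. by rewrite !lift_mul liftZ. Qed.

Lemma path_mulDr : right_distributive path_mul +%R.
Proof.
move=> f g h; rewrite !lift_mul -big_split; apply: eq_bigr => p _ /=.
by rewrite liftD scalerDr.
Qed.

Lemma path_mulZr c f g : path_mul f (c *: g) = c *: path_mul f g.
Proof.
rewrite !lift_mul scaler_sumr; apply: eq_bigr => p _ /=.
by rewrite liftZ !scalerA mulrC.
Qed.

Lemma path_mul0l f : path_mul 0 f = 0.
Proof. by rewrite -(scale0r (0 : A)) path_mulZl !scale0r. Qed.

Lemma path_mul0r f : path_mul f 0 = 0.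
Proof. by rewrite -(scale0r (0 : A)) path_mulZr !scale0r. Qed.

Lemma path_mul_elt p q :
  path_mul (path_elt K p) (path_elt K q) = path_concat_elt K p q.
Proof. by rewrite lift_mul !liftU. Qed.

Lemma path_mulA : associative path_mul.
Proof.
move=> f g h.
elim/path_algebra_ind: f => [|f1 f2 e1 e2|c f e|p].
- by rewrite !path_mul0l.
- by rewrite !path_mulDl e1 e2.
- by rewrite !path_mulZl e.
elim/path_algebra_ind: g => [|f1 f2 e1 e2|c f e|q].
- by rewrite path_mul0l !path_mul0r path_mul0l.
- by rewrite !(path_mulDl, path_mulDr) e1 e2.
- by rewrite !(path_mulZl, path_mulZr) e.
elim/path_algebra_ind: h => [|f1 f2 e1 e2|c f e|r].
- by rewrite !path_mul0r.
- by rewrite !path_mulDr e1 e2.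
- by rewrite !path_mulZr e.
rewrite !path_mul_elt /path_concat_elt.
case: (path_concatP q r) => [s eqr ss es as_|nqr];
  case: (path_concatP p q) => [t epq st et at_|npq];
  rewrite ?path_mul0l ?path_mul0r ?path_mul_elt /path_concat_elt //.
- case: path_concatP => [u _ su _ au|]; last by rewrite ss epq eqxx.
  case: path_concatP => [w _ sw _ aw|]; last by rewrite et eqr eqxx.
  congr path_elt; apply: qpath_eq; first by rewrite su sw st.
  by rewrite au aw as_ at_ catA.
- by case: path_concatP => // u e; rewrite -ss e eqxx in npq *.
- by case: path_concatP => // u e; rewrite -et e eqxx in nqr *.
Qed.

Lemma path_mul1l : left_id path_one path_mul.
Proof.
elim/path_algebra_ind => [|f g ef eg|c f ef|p].
- by rewrite path_mul0r.
- by rewrite path_mulDr ef eg.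
- by rewrite path_mulZr ef.
have -> g : path_mul path_one g =
    \sum_v path_mul (path_elt K (trivial_path v)) g.
  by apply: (big_morph (path_mul^~ g)) => [f h|]; rewrite ?path_mulDl ?path_mul0l.
rewrite (bigD1 (path_start p)) //= big1 ?addr0 => [|v nv]; rewrite path_mul_elt.
  rewrite /path_concat_elt; case: path_concatP => [r _ sr _ ar|/eqP//].
  by congr path_elt; apply: qpath_eq.
rewrite /path_concat_elt; case: path_concatP => // r e.
by rewrite -e eqxx in nv.
Qed.

Lemma path_mul1r : right_id path_one path_mul.
Proof.
elim/path_algebra_ind => [|f g ef eg|c f ef|p].
- by rewrite path_mul0l.
- by rewrite path_mulDl ef eg.
- by rewrite path_mulZl ef.
have -> g : path_mul g path_one =
    \sum_v path_mul g (path_elt K (trivial_path v)).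
  by apply: (big_morph (path_mul g)) => [f h|]; rewrite ?path_mulDr ?path_mul0r.
rewrite (bigD1 (path_end p)) //= big1 ?addr0 => [|v nv]; rewrite path_mul_elt.
  rewrite /path_concat_elt; case: path_concatP => [r _ sr _ ar|/eqP//].
  by congr path_elt; apply: qpath_eq; rewrite // ar cats0.
rewrite /path_concat_elt; case: path_concatP => // r e.
by rewrite e eqxx in nv.
Qed.

HB.instance Definition _ := GRing.Zmodule_isPzRing.Build A
  path_mulA path_mul1l path_mul1r path_mulDl path_mulDr.

Lemma path_eltM p q :
  path_elt K p * path_elt K q =
  if path_concat p q is Some r then path_elt K r else 0.
Proof. exact: path_mul_elt. Qed.

Lemma path_scalerAl (c : K) f g : c *: (f * g) = (c *: f) * g.
Proof. by rewrite [in RHS]/GRing.mul /= path_mulZl. Qed.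

Lemma path_scalerAr (c : K) f g : c *: (f * g) = f * (c *: g).
Proof. by rewrite [in RHS]/GRing.mul /= path_mulZr. Qed.

End PathAlgebra.

Section Occurrences.
Variables (G0 G1 : finType) (content : G1 -> {mset G0}%mset).

(** The occurrences of a vertex [alpha] in a polygon [V] are told apart by an
    index below the multiplicity of [alpha] in [V]. *)
Definition occurrence : finType := {x : G0 * G1 & 'I_(content x.2 x.1)}.

Definition occ_vertex (x : occurrence) : G0 := (tag x).1.
Definition occ_polygon (x : occurrence) : G1 := (tag x).2.

Definition valency (alpha : G0) : nat := (\sum_V content V alpha)%N.

End Occurrences.

(** [bc_next] sends an occurrence of [alpha] to the next one in the cyclic
    ordering at [alpha]: its orbits are the sets of all occurrences of a vertex. *)
Record brauer_configuration := BrauerConfiguration {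
  bc_vertex : finType;
  bc_polygon : finType;
  bc_content : bc_polygon -> {mset bc_vertex}%mset;
  bc_mult : bc_vertex -> nat;
  bc_next : {perm occurrence bc_content};
  bc_mult_gt0 : forall alpha, (0 < bc_mult alpha)%N;
  bc_next_cyclic : forall x y : occurrence bc_content,
    (y \in porbit bc_next x) = (occ_vertex x == occ_vertex y);
  bc_vertex_covered : forall alpha, exists V, alpha \in bc_content V;
  bc_polygon_size : forall V, (2 <= size (bc_content V))%N;
  bc_polygon_nontruncated : forall V, exists2 alpha, alpha \in bc_content V &
    (1 < valency bc_content alpha * bc_mult alpha)%N
}.

Section BrauerConfiguration.
Variable G : brauer_configuration.
Implicit Types (alpha : bc_vertex G) (V : bc_polygon G).

Definition truncated alpha : bool :=
  (valency (@bc_content G) alpha * bc_mult alpha == 1)%N.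

Definition no_truncated_vertex V : bool :=
  [forall alpha, (alpha \in bc_content V) ==> ~~ truncated alpha].

Definition two_gon_with_one_truncated V : bool :=
  (size (bc_content V) == 2)%N && (count truncated (bc_content V) == 1)%N.

Definition reduced : Prop :=
  forall V, no_truncated_vertex V \/ two_gon_with_one_truncated V.

(** The arrow of the quiver going from the polygon of an occurrence [x] of a
    nontruncated vertex to the polygon of the next occurrence is [x] itself. *)
Definition bc_arrow : finType :=
  {x : occurrence (@bc_content G) | ~~ truncated (occ_vertex x)}.

Definition arrow_vertex (a : bc_arrow) : bc_vertex G := occ_vertex (val a).

Definition brauer_quiver : quiver := {|
  quiver_vertex := bc_polygon G;
  quiver_arrow := bc_arrow;
  source := fun a => occ_polygon (val a);
  target := fun a => occ_polygon (bc_next G (val a))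
|}.

Lemma occ_vertex_next x : occ_vertex (bc_next G x) = occ_vertex x.
Proof.
apply/esym/eqP; rewrite -bc_next_cyclic.
by have := mem_porbit (bc_next G) 1 x; rewrite expg1.
Qed.

Lemma next_arrow_subproof (a : bc_arrow) :
  ~~ truncated (occ_vertex (bc_next G (val a))).
Proof. by rewrite occ_vertex_next; exact: valP a. Qed.

Definition next_arrow (a : bc_arrow) : bc_arrow :=
  exist _ (bc_next G (val a)) (next_arrow_subproof a).

Lemma special_cycle_subproof (a : bc_arrow) n :
  @is_path brauer_quiver (occ_polygon (val a)) (traject next_arrow a n).
Proof. by elim: n a => //= n IH a; rewrite eqxx; exact: IH (next_arrow a). Qed.

(** A special cycle is determined by its first arrow [a]: it runs once through
    the successor sequence. Special alpha-cycles at [v] correspond to arrows [a]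
    starting at [v] with [arrow_vertex a] equal to alpha. *)
Definition special_cycle (a : bc_arrow) : qpath brauer_quiver :=
  mk_path
    (special_cycle_subproof a (valency (@bc_content G) (arrow_vertex a))).

Definition special_cycles_at V : {fset qpath brauer_quiver} :=
  [fset special_cycle a | a : bc_arrow & occ_polygon (val a) == V]%fset.

End BrauerConfiguration.

Section BrauerAlgebra.
Variables (K : fieldType) (G : brauer_configuration).
Local Notation Q := (brauer_quiver G).
Local Notation KQ := (path_algebra K Q).

(** [special_cycle_power a] is C ^ mu(alpha), for C the special alpha-cycle
    starting with [a]. *)
Definition special_cycle_power (a : bc_arrow G) : KQ :=
  path_elt K (special_cycle a) ^+ bc_mult (arrow_vertex a).

Definition relations_one : set KQ :=
  [set x | exists a b : bc_arrow G, occ_polygon (val a) = occ_polygon (val b) /\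
    x = special_cycle_power a - special_cycle_power b].

Definition relations_two : set KQ :=
  [set x | exists a : bc_arrow G,
    x = special_cycle_power a * path_elt K (@arrow_path Q a)].

Definition relations_three : set KQ :=
  [set x | exists a b : bc_arrow G, [/\ @target Q a = @source Q b,
    forall c, ~~ infix [:: a; b] (path_arrows (special_cycle c)),
    ~~ [&& a == b, valency (@bc_content G) (arrow_vertex a) == 1%N &
           (1 < bc_mult (arrow_vertex a))%N] &
    x = path_elt K (@arrow_path Q a) * path_elt K (@arrow_path Q b)]].

Definition brauer_ideal : set KQ :=
  ideal_generated (relations_one `|` relations_two `|` relations_three).

Lemma brauer_ideal_ideal : two_sided_ideal brauer_ideal.
Proof. exact: ideal_generated_ideal. Qed.

Definition brauer_algebra : pzRingType := quot_ring brauer_ideal_ideal.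

Definition path_image (p : qpath Q) : brauer_algebra :=
  quot_ring_class brauer_ideal_ideal (path_elt K p).

(** The right regular module: right modules over a ring [R] are left modules
    over the converse ring [R^c], so that [a *: x] is [x * a] in [R]. *)
Definition regular_module : lmodType brauer_algebra^c := (brauer_algebra^c)^o.

Definition projective_module (V : bc_polygon G) : set regular_module :=
  [set path_image (@trivial_path Q V) * x | x in [set: brauer_algebra]].

Definition first_arrow_module (C : qpath Q) : set regular_module :=
  submodule_generated [set (path_image (path_prefix 1 C) : regular_module)].

End BrauerAlgebra.

Arguments relations_one K G : clear implicits.
Arguments relations_two K G : clear implicits.
Arguments relations_three K G : clear implicits.
Arguments brauer_ideal K G : clear implicits.
Arguments path_image K {G} p.
Arguments projective_module K {G} V.
Arguments first_arrow_module K {G} C.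

(* Main.v *)
(** Write [L] for the length of the power of a special cycle occurring in the
    relations. Modulo the relations every path is zero, trivial, or a prefix of
    length at most [L] of such a power, and all these powers starting at [v] have
    the same image [s_v]. The classes so obtained are independent because the
    elements of the path algebra whose coordinates on them vanish form a
    two-sided ideal containing the relations.

    If [p] is a path, every element of [p Lambda] is [p (c + w)] with [c] a scalar
    and [w] in the arrow ideal, which is nilpotent. So either [c <> 0] and [c + w]
    is invertible, hence the element generates [p Lambda], or the element is in
    [p rad]. For [p] a prefix of a power of a special cycle, [p rad] is generated
    by the next prefix, so that [U_1(C)] is uniserial; for [p = e_v] this gives
    that the sum of the [U_1(C)] is the only maximal submodule of [P].

    An element of [P] killed by all arrows has zero coordinate on every prefix
    shorter than [L], so it is a multiple of [s_v]; multiplying a nonzero element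
    by a longest path that does not kill it shows that [s_v] is in every nonzero
    submodule of [P]. Independence then gives the intersections and the
    decomposition of the heart. *)
Require Import Defs.
From mathcomp Require Import all_boot all_algebra perm.
From mathcomp Require Import finmap multiset monalg.
From mathcomp Require Import boolp classical_sets.

Set Implicit Arguments.
Unset Strict Implicit.
Unset Printing Implicit Defensive.

Import GRing.Theory.
Local Open Scope ring_scope.
Local Open Scope classical_set_scope.

(** * Coefficients and order in a path algebra *)

Section PathAlgebraCoefficients.
Variables (K : fieldType) (Q : quiver).
Local Notation A := (path_algebra K Q).
Implicit Types (f g : A) (p q r : qpath Q).

Lemma path_elt_coeff p q : (path_elt K p)@_q = (p == q)%:R.
Proof. by rewrite path_elt.unlock; exact: mcoeffU. Qed.

Lemma path_algebra_suppE f : f = \sum_(p <- msupp f) f@_p *: path_elt K p.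
Proof.
have e c p : << c *g p >> = c *: path_elt K p :> A.
  apply/malgP => q; rewrite path_coeffZ path_elt_coeff mulr_natr.
  exact: mcoeffU.
by rewrite {1}[f]monalgE; apply: eq_bigr => p _; rewrite e.
Qed.

Definition path_size p : nat := size (path_arrows p).

(** Membership in the [l]-th power of the arrow ideal, expressed through coefficients. *)
Definition order_ge (l : nat) f : Prop :=
  forall p, (path_size p < l)%N -> f@_p = 0.

Lemma order_ge0 f : order_ge 0 f.
Proof. by []. Qed.

Lemma order_ge_zero l : order_ge l (0 : A).
Proof. by move=> p _; exact: mcoeff0. Qed.

Lemma order_geD l f g : order_ge l f -> order_ge l g -> order_ge l (f + g).
Proof. by move=> hf hg p lp; rewrite mcoeffD hf ?hg ?addr0. Qed.

Lemma order_geZ l (c : K) f : order_ge l f -> order_ge l (c *: f).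
Proof. by move=> hf p lp; rewrite path_coeffZ hf ?mulr0. Qed.

Lemma order_ge_elt p : order_ge (path_size p) (path_elt K p).
Proof.
move=> q; rewrite path_elt_coeff.
by case: (eqVneq p q) => // ->; rewrite ltnn.
Qed.

Lemma order_ge_le m n f : (m <= n)%N -> order_ge n f -> order_ge m f.
Proof. by move=> mn hf p pm; apply: hf; apply: leq_trans mn. Qed.

(** An element is a combination of the paths in its support, and the bound excludes every path
    shorter than [l] from that support. *)
Lemma order_ge_ind l (T : A -> Prop) : T 0 ->
  (forall f g, T f -> T g -> T (f + g)) -> (forall c f, T f -> T (c *: f)) ->
  (forall p, (l <= path_size p)%N -> T (path_elt K p)) ->
  forall f, order_ge l f -> T f.
Proof.
move=> T0 TD TZ TE f hf; rewrite [f]path_algebra_suppE big_seq.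
apply: (big_ind T) => // p pf; apply/TZ/TE.
rewrite leqNgt; apply/negP => /hf /eqP.
by rewrite mcoeff_eq0 pf.
Qed.

Lemma order_geM m n f g :
  order_ge m f -> order_ge n g -> order_ge (m + n) (f * g).
Proof.
move=> hf hg; elim/(@order_ge_ind m): f / hf => [|f1 f2 e1 e2|c f e|p mp].
- by rewrite mul0r; exact: order_ge_zero.
- by rewrite mulrDl; exact: order_geD.
- by rewrite -path_scalerAl; exact: order_geZ.
elim/(@order_ge_ind n): g / hg => [|f1 f2 e1 e2|c f e|q nq].
- by rewrite mulr0; exact: order_ge_zero.
- by rewrite mulrDr; exact: order_geD.
- by rewrite -path_scalerAr; exact: order_geZ.
rewrite path_eltM; case: path_concatP => [r _ _ _ ar|_];
  last exact: order_ge_zero.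
apply: (@order_ge_le _ (path_size r)); last exact: order_ge_elt.
by rewrite /path_size ar size_cat leq_add.
Qed.

Lemma order_geX n f : order_ge 1 f -> order_ge n (f ^+ n).
Proof.
move=> hf; elim: n => [|n IH]; first exact: order_ge0.
by rewrite exprS -add1n; exact: order_geM.
Qed.

Lemma path_concat_injr p q q' r :
  path_concat p q = Some r -> path_concat p q' = Some r -> q = q'.
Proof.
case: path_concatP => // r1 e1 _ _ a1 [<-];
  case: path_concatP => // r2 e2 _ _ a2 [er].
apply: qpath_eq; first by rewrite -e1 -e2.
have := a1; rewrite -er a2 => /eqP; rewrite eqseq_cat // eqxx => /eqP -> //.
Qed.

Lemma path_concat_injl p p' q r :
  path_concat p q = Some r -> path_concat p' q = Some r -> p = p'.
Proof.
case: path_concatP => // r1 _ s1 _ a1 [<-];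
  case: path_concatP => // r2 _ s2 _ a2 [er].
apply: qpath_eq; first by rewrite -s1 -s2 er.
have := a1; rewrite -er a2 => /eqP; rewrite eqseq_cat;
  first by case/andP => /eqP ->.
have := congr1 size a1; rewrite -er a2 !size_cat => /eqP.
by rewrite eqn_add2r => /eqP.
Qed.

(** Paths can be cancelled on the right, so [p] is the only path whose product with [q] is [r].
    Together with the next lemma this computes all coefficients of a product by a path. *)
Lemma coeff_mul_pathr f p q r : path_concat p q = Some r ->
  (f * path_elt K q)@_r = f@_p.
Proof.
move=> pqr; elim/path_algebra_ind: f => [|f1 f2 e1 e2|c f e|s].
- by rewrite mul0r !mcoeff0.
- by rewrite mulrDl !mcoeffD e1 e2.
- by rewrite -path_scalerAl !path_coeffZ e.
rewrite path_eltM path_elt_coeff; case: (eqVneq s p) => [->|sp].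
  by rewrite pqr path_elt_coeff eqxx.
case e: path_concat => [t|]; last by rewrite mcoeff0.
rewrite path_elt_coeff; case: eqP => // tr; case/eqP: sp.
by apply: path_concat_injl pqr; rewrite -tr.
Qed.

Lemma coeff_mul_pathr0 f q r : (forall p, path_concat p q <> Some r) ->
  (f * path_elt K q)@_r = 0.
Proof.
move=> h; elim/path_algebra_ind: f => [|f1 f2 e1 e2|c f e|s].
- by rewrite mul0r mcoeff0.
- by rewrite mulrDl mcoeffD e1 e2 addr0.
- by rewrite -path_scalerAl path_coeffZ e mulr0.
rewrite path_eltM; case e: path_concat => [t|]; last by rewrite mcoeff0.
by rewrite path_elt_coeff; case: eqP => // tr; case: (h s); rewrite -tr.
Qed.

Lemma coeff_mul_pathl f p q r : path_concat q p = Some r ->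
  (path_elt K q * f)@_r = f@_p.
Proof.
move=> pqr; elim/path_algebra_ind: f => [|f1 f2 e1 e2|c f e|s].
- by rewrite mulr0 !mcoeff0.
- by rewrite mulrDr !mcoeffD e1 e2.
- by rewrite -path_scalerAr !path_coeffZ e.
rewrite path_eltM path_elt_coeff; case: (eqVneq s p) => [->|sp].
  by rewrite pqr path_elt_coeff eqxx.
case e: path_concat => [t|]; last by rewrite mcoeff0.
rewrite path_elt_coeff; case: eqP => // tr; case/eqP: sp.
by apply: path_concat_injr pqr; rewrite -tr.
Qed.

Lemma coeff_mul_pathl0 f q r : (forall p, path_concat q p <> Some r) ->
  (path_elt K q * f)@_r = 0.
Proof.
move=> h; elim/path_algebra_ind: f => [|f1 f2 e1 e2|c f e|s].
- by rewrite mulr0 mcoeff0.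
- by rewrite mulrDr mcoeffD e1 e2 addr0.
- by rewrite -path_scalerAr path_coeffZ e mulr0.
rewrite path_eltM; case e: path_concat => [t|]; last by rewrite mcoeff0.
by rewrite path_elt_coeff; case: eqP => // tr; case: (h s); rewrite -tr.
Qed.

End PathAlgebraCoefficients.

(** * Prefixes of the powers of special cycles *)

Lemma count_sum_mem (T : finType) (P : pred T) (s : seq T) :
  count P s = (\sum_(x | P x) count_mem x s)%N.
Proof.
elim: s => [|y s IH] /=; first by rewrite big1.
rewrite big_split /= -IH; congr (_ + _)%N.
rewrite big_mkcond (bigD1 y) //= eqxx big1 ?addn0 => [|x xy];
  first by case: (P y).
by rewrite eq_sym (negPf xy); case: (P x).
Qed.

Section SpecialPaths.
Variable G : brauer_configuration.
Local Notation Q := (brauer_quiver G).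
Implicit Types (a b c : bc_arrow G) (V : bc_polygon G).
Local Notation next := (@next_arrow G).
Local Notation src a := (occ_polygon (val a)).
Local Notation val_ a := (valency (@bc_content G) (arrow_vertex a)).

Lemma card_occurrence (p : pred (bc_vertex G * bc_polygon G)) :
  #|[pred x : occurrence (@bc_content G) | p (tag x)]| =
  (\sum_(x | p x) bc_content x.2 x.1)%N.
Proof.
rewrite -sum1_card.
under [RHS]eq_bigr => x _ do rewrite -[bc_content _ _]card_ord -sum1_card.
by rewrite (sig_big_dep _ (fun _ _ => true) (fun _ _ => 1%N));
  apply: eq_bigl => x /=; rewrite andbT.
Qed.

Lemma card_vertex_occurrences (alpha : bc_vertex G) :
  #|[pred x : occurrence (@bc_content G) | occ_vertex x == alpha]| =
  valency (@bc_content G) alpha.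
Proof.
rewrite (card_occurrence (fun x => x.1 == alpha)).
under eq_bigl => x do rewrite -[_ == _]andbT.
transitivity (\sum_(x | x == alpha) \sum_W bc_content W x)%N.
  exact/esym/(pair_big_dep (pred1 alpha) (fun _ _ => true) (fun x W =>
    bc_content W x)).
by rewrite big_pred1_eq.
Qed.

(** An arrow is an occurrence of a nontruncated vertex. This count later becomes the number [r] of
    special cycles at [V]. *)
Lemma card_arrows_at V :
  #|[pred a : bc_arrow G | src a == V]| = count (predC (@truncated G))
    (bc_content V).
Proof.
rewrite count_sum_mem; under eq_bigr => x _ do rewrite count_mem_mset.
transitivity (\sum_(x | ~~ truncated x) \sum_(W | W == V) bc_content W x)%N;
  last first.
  by apply: eq_bigr => x _; rewrite big_pred1_eq.
transitivity (\sum_(x | ~~ truncated x.1 && (x.2 == V)) bc_content x.2 x.1)%N;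
  last first.
  exact/esym/(pair_big_dep (predC (@truncated G)) (fun _ => pred1 V) (fun x W
    => bc_content W x)).
rewrite -(card_occurrence (fun x => ~~ truncated x.1 && (x.2 == V))).
rewrite -(card_image (@val_inj _ _ (bc_arrow G))); apply: eq_card => x.
apply/fintype.imageP/idP => [[a aV ->]|]; first by rewrite inE (valP a).
rewrite inE => /andP[x1 x2].
by exists (exist _ x x1).
Qed.

Lemma exists_arrow_at V : exists a, src a = V.
Proof.
have [alpha aV lt1] := bc_polygon_nontruncated V.
rewrite in_mset in aV.
have nt : ~~ truncated alpha by rewrite /truncated neq_ltn lt1 orbT.
pose x : occurrence (@bc_content G) :=
  existT (fun x => 'I_(bc_content x.2 x.1)) (alpha, V) (Ordinal aV).
by exists (exist _ x nt).
Qed.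

Lemma val_iter_next k a : val (iter k next a) = iter k (bc_next G) (val a).
Proof. by elim: k => //= k ->. Qed.

Lemma arrow_vertex_next a : arrow_vertex (next a) = arrow_vertex a.
Proof. exact: occ_vertex_next. Qed.

Lemma arrow_vertex_iter k a : arrow_vertex (iter k next a) = arrow_vertex a.
Proof. by elim: k => //= k IH; rewrite arrow_vertex_next. Qed.

(** The orbit of an occurrence under [bc_next] consists of all occurrences of its vertex, so its
    size is the valency. *)
Lemma iter_next_valency a : iter (val_ a) next a = a.
Proof.
apply: val_inj; rewrite val_iter_next -card_vertex_occurrences.
rewrite -[RHS](iter_porbit (bc_next G)); congr (iter _ _ _);
  apply: eq_card => x.
by rewrite !inE bc_next_cyclic eq_sym.
Qed.

Lemma valency_gt0 a : (0 < val_ a)%N.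
Proof.
rewrite -card_vertex_occurrences; apply/card_gt0P; exists (val a).
by rewrite inE.
Qed.

(** The length L of $C^{\mu(\alpha)}$, for $C$ the special $\alpha$-cycle with first arrow [a]. *)
Definition power_length a : nat := (val_ a * bc_mult (arrow_vertex a))%N.

Lemma power_length_gt1 a : (1 < power_length a)%N.
Proof.
have := valP a; rewrite /= /truncated -/(arrow_vertex a) -/(power_length a).
have: (0 < power_length a)%N by rewrite muln_gt0 valency_gt0 bc_mult_gt0.
by case: power_length => [|[]].
Qed.

Lemma power_length_iter k a : power_length (iter k next a) = power_length a.
Proof. by rewrite /power_length arrow_vertex_iter. Qed.

Lemma iter_next_power_length a : iter (power_length a) next a = a.
Proof.
rewrite /power_length mulnC; elim: (bc_mult _) => // m IH.
by rewrite mulSn iterD IH iter_next_valency.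
Qed.

(** For [k] at most [power_length a] this is a prefix of the power of the special cycle starting
    with [a]. Larger [k] is allowed, so that concatenation needs no bound. *)
Definition special_path a k : qpath Q := mk_path (special_cycle_subproof a k).
Local Notation tp := special_path.

Lemma special_path_size a k : path_size (tp a k) = k.
Proof. exact: size_traject. Qed.

Lemma special_path0 a : tp a 0 = @trivial_path Q (src a).
Proof. exact: qpath_eq. Qed.

Lemma special_path_end a k : path_end (tp a k) = src (iter k next a).
Proof.
rewrite /path_end /path_start /path_arrows /=.
by elim: k a => // k IH a; rewrite iterSr -IH.
Qed.

(** A path of length 0 remembers only its polygon, hence the guard on the equality of arrows. *)
Lemma special_path_inj a b k l : tp a k = tp b l -> k = l /\ ((0 < k)%N ->
  a = b).
Proof.
move=> e; have kl : k = l by rewrite -(special_path_size a k) e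
  special_path_size.
by split=> //; move: e; rewrite -{}kl; case: k => // k /(congr1 (@path_arrows
  _)) [].
Qed.

Lemma path_concat_special a k l :
  path_concat (tp a k) (tp (iter k next a) l) = Some (tp a (k + l)).
Proof.
case: path_concatP => [r e s _ ar|]; last by rewrite special_path_end eqxx.
by congr Some; apply: qpath_eq => //; rewrite ar /= /path_arrows /= trajectD.
Qed.

(** Special paths are closed under taking prefixes and suffixes. This is what makes vanishing of
    coordinates stable under multiplication by paths. *)
Lemma path_concat_specialP p q a k : path_concat p q = Some (tp a k) ->
  [/\ (path_size p + path_size q = k)%N, p = tp a (path_size p) &
      q = tp (iter (path_size p) next a) (path_size q)].
Proof.
case: path_concatP => // r epq sr er ar [rE].
have ek : (path_size p + path_size q = k)%N.
  by rewrite -(special_path_size a k) -rE /path_size ar size_cat.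
have pE : p = tp a (path_size p).
  apply: qpath_eq; first by rewrite -sr rE.
  have := congr1 (take (path_size p)) ar; rewrite take_size_cat // => <-.
  by rewrite rE /= /path_arrows /= take_traject // -ek leq_addr.
split=> //; have := path_concat_special a (path_size p) (path_size q).
rewrite -pE ek -rE => h; apply: path_concat_injr h.
by case: path_concatP => [r' _ s' _ a'|]; [congr Some; apply: qpath_eq;
  rewrite ?s' ?a'|rewrite epq eqxx].
Qed.

Lemma infix_special_cycle a b c :
  infix [:: a; b] (path_arrows (special_cycle c)) -> b = next a.
Proof.
move=> /infixP[s [s' e]].
have : sorted (frel next) (path_arrows (special_cycle c)).
  rewrite /special_cycle /path_arrows /=; case: (val_ c) => //= n.
  exact: fpath_traject.
by rewrite e => /cat_sorted2[_] /= /andP[/eqP].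
Qed.

(** If [b] is [next a] and the valency is at least 2, then [ab] lies on a special cycle. If the
    valency is 1, then [a] is a loop equal to [b], and nontruncation forces multiplicity above 1,
    which is the excluded case. *)
Lemma relations_threeE (K : fieldType) (x : path_algebra K Q) :
  relations_three K G x <-> exists a b, [/\ @target Q a = @source Q b,
    b <> next a &
    x = path_elt K (@arrow_path Q a) * path_elt K (@arrow_path Q b)].
Proof.
split=> [[a [b [ab ni ne ->]]]|[a [b [ab nb ->]]]]; exists a, b; split=> //.
- move=> bE; have v0 := valency_gt0 a.
  have [v1|v1] : (val_ a == 1)%N \/ (1 < val_ a)%N.
    by case: (valency _ _) v0 => [|[|n]] // _; [left | right].
    have aE : next a = a by rewrite -{2}(iter_next_valency a) (eqP v1).
    move: ne; rewrite bE aE eqxx v1 /= -leqNgt => m1.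
    have := power_length_gt1 a; rewrite /power_length (eqP v1) mul1n.
    by rewrite ltnNge m1.
  case/negP: (ni a); rewrite bE /special_cycle /path_arrows /=.
  case: (val_ a) v1 => [|[|n]] // _; exact: (@prefix_infix _ [:: _; _]).
- by move=> c; apply/negP => /infix_special_cycle.
apply/negP => /and3P[/eqP ab' v1 _]; apply: nb.
by rewrite -ab' -{1}(iter_next_valency a) (eqP v1).
Qed.

Lemma path_elt_special (K : fieldType) a k l :
  path_elt K (tp a k) * path_elt K (tp (iter k next a) l) = path_elt K (tp a (k
    + l)).
Proof. by rewrite path_eltM path_concat_special. Qed.

Lemma special_cycle_powerE (K : fieldType) a :
  special_cycle_power K a = path_elt K (tp a (power_length a)).
Proof.
rewrite /special_cycle_power /power_length.
have := bc_mult_gt0 (arrow_vertex a); case: (bc_mult _) => // m _.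
elim: m => [|m IH]; first by rewrite expr1 muln1.
by rewrite exprS {}IH [in RHS]mulnS -path_elt_special iter_next_valency.
Qed.

Lemma special_path1 a : tp a 1 = @arrow_path Q a.
Proof. exact: qpath_eq. Qed.

End SpecialPaths.

(** * Linear independence *)

Section LinearIndependence.
Variables (K : fieldType) (G : brauer_configuration).
Local Notation Q := (brauer_quiver G).
Local Notation KQ := (path_algebra K Q).
Implicit Types (a b c : bc_arrow G) (V : bc_polygon G) (f g : KQ) (p q :
  qpath Q).
Local Notation next := (@next_arrow G).
Local Notation src a := (occ_polygon (val a)).

(** The coordinates of the class of [f] on the basis of the algebra formed by
    the special paths shorter than the power of the special cycle, and by one
    socle element for each polygon. *)
Definition coordinates_vanish f : Prop :=
  (forall a k, (k < power_length a)%N -> f@_(special_path a k) = 0) /\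
  (forall V, \sum_(a | src a == V) f@_(special_path a (power_length a)) = 0).

Lemma coordinates_vanishD f g :
  coordinates_vanish f -> coordinates_vanish g -> coordinates_vanish (f + g).
Proof.
move=> [f1 f2] [g1 g2]; split=> [a k ak|V].
  by rewrite mcoeffD f1 ?g1 ?addr0.
by under eq_bigr => a _ do rewrite mcoeffD; rewrite big_split /= f2 g2 addr0.
Qed.

Lemma coordinates_vanishZ (x : K) f :
  coordinates_vanish f -> coordinates_vanish (x *: f).
Proof.
move=> [f1 f2]; split=> [a k ak|V].
  by rewrite path_coeffZ f1 ?mulr0.
by under eq_bigr => a _ do rewrite path_coeffZ; rewrite -mulr_sumr f2 mulr0.
Qed.

Lemma coordinates_vanish0 : coordinates_vanish (0 : KQ).
Proof.
by split=> [a k ak|V]; [|rewrite big1 // => a _]; exact: mcoeff0.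
Qed.

(** The coefficient of the product on a special path is zero or the coefficient of [f] on a prefix
    shorter by the length of [q]. If [q] is nontrivial, even the coefficients at length L come from
    coefficients below L. *)
Lemma coordinates_vanish_mul_pathr f q :
  coordinates_vanish f -> coordinates_vanish (f * path_elt K q).
Proof.
move=> [f1 f2].
have short a k : (k < power_length a)%N || (0 < path_size q)%N && (k ==
  power_length a) ->
    (f * path_elt K q)@_(special_path a k) = 0.
  move=> hk; have [[p pq]|np] := EM (exists p,
    path_concat p q = Some (special_path a k)); last first.
    by apply: coeff_mul_pathr0 => p pq; apply: np; exists p.
  rewrite (coeff_mul_pathr _ pq); have [e -> _] := path_concat_specialP pq.
  apply: f1; case/orP: hk => [|/andP[q0 /eqP <-]]; rewrite -e.
    by apply: leq_ltn_trans; exact: leq_addr.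
  by rewrite -addn1 leq_add2l.
split=> [a k ak|V]; first by apply: short; rewrite ak.
(* A trivial [q] at [V] preserves the sum at [V], since the powers starting at [V] also end there; a
   trivial [q] elsewhere kills every term. *)
have [q0|q0] := posnP (path_size q); last first.
  by rewrite big1 // => a _; apply: short; rewrite q0 eqxx orbT.
have [qV|qV] := eqVneq (path_start q) V.
  rewrite -[RHS](f2 V); apply: eq_bigr => a /eqP aV.
  apply: coeff_mul_pathr; case: path_concatP => [r e s _ ar|/eqP[]].
    congr Some; apply: qpath_eq => //.
    by rewrite ar (size0nil q0) cats0.
  by rewrite special_path_end iter_next_power_length aV.
rewrite big1 // => a /eqP aV; apply: coeff_mul_pathr0 => p pq.
have [_ pE] := path_concat_specialP pq.
rewrite q0 => qE; case/eqP: qV.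
have [e] : path_size p = power_length a.
  by have [<-] := path_concat_specialP pq; rewrite q0 addn0.
by rewrite qE e iter_next_power_length.
Qed.

(** The same argument with suffixes; L is constant along a successor sequence, so the bound is
    unchanged. *)
Lemma coordinates_vanish_mul_pathl f q :
  coordinates_vanish f -> coordinates_vanish (path_elt K q * f).
Proof.
move=> [f1 f2].
have short a k : (k < power_length a)%N || (0 < path_size q)%N && (k ==
  power_length a) ->
    (path_elt K q * f)@_(special_path a k) = 0.
  move=> hk; have [[p pq]|np] := EM (exists p,
    path_concat q p = Some (special_path a k)); last first.
    by apply: coeff_mul_pathl0 => p pq; apply: np; exists p.
  rewrite (coeff_mul_pathl _ pq); have [e _ ->] := path_concat_specialP pq.
  apply: f1; rewrite power_length_iter; case/orP: hk => [|/andP[q0 /eqP <-]];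
    rewrite -e.
    by apply: leq_ltn_trans; exact: leq_addl.
  by rewrite -add1n leq_add2r.
split=> [a k ak|V]; first by apply: short; rewrite ak.
have [q0|q0] := posnP (path_size q); last first.
  by rewrite big1 // => a _; apply: short; rewrite q0 eqxx orbT.
have qe : path_end q = path_start q by rewrite /path_end (size0nil q0).
have [qV|qV] := eqVneq (path_start q) V.
  rewrite -[RHS](f2 V); apply: eq_bigr => a /eqP aV.
  apply: coeff_mul_pathl; case: path_concatP => [r e s _ ar|/eqP[]].
    congr Some; apply: qpath_eq; first by rewrite s -e.
    by rewrite ar (size0nil q0).
  by rewrite qe qV -aV.
rewrite big1 // => a /eqP aV; apply: coeff_mul_pathl0 => p pq.
have [_ qE _] := path_concat_specialP pq.
by case/eqP: qV; rewrite qE.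
Qed.

Lemma coordinates_vanish_ideal : two_sided_ideal coordinates_vanish.
Proof.
split; first split.
- exact: coordinates_vanish0.
- move=> f g hf hg; apply: coordinates_vanishD => //.
  by rewrite -scaleN1r; exact: coordinates_vanishZ.
- move=> g f hf; elim/path_algebra_ind: g => [|g1 g2 e1 e2|x g e|p].
  + by rewrite mul0r; exact: coordinates_vanish0.
  + by rewrite mulrDl; exact: coordinates_vanishD.
  + by rewrite -path_scalerAl; exact: coordinates_vanishZ.
  exact: coordinates_vanish_mul_pathl.
- move=> g f hf; elim/path_algebra_ind: g => [|g1 g2 e1 e2|x g e|p].
  + by rewrite mulr0; exact: coordinates_vanish0.
  + by rewrite mulrDr; exact: coordinates_vanishD.
  + by rewrite -path_scalerAr; exact: coordinates_vanishZ.
  exact: coordinates_vanish_mul_pathr.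
Qed.

Lemma coordinates_vanish_path p :
  (forall a k, (k <= power_length a)%N -> p <> special_path a k) ->
  coordinates_vanish (path_elt K p).
Proof.
move=> h; split=> [a k ak|V]; last (rewrite big1 // => a _);
  rewrite path_elt_coeff.
  by case: eqP => // /h; case; exact: ltnW.
by case: eqP => // /h; case.
Qed.

(** Powers with distinct first arrows are distinct paths, so at most the term [b = a] survives. This
    handles the type one relations and shows that the socle element is nonzero. *)
Lemma sum_coeff_special_power a V :
  \sum_(b | src b == V)
    (path_elt K (special_path a (power_length a)))@_(special_path b
      (power_length b)) =
  (src a == V)%:R.
Proof.
have e b : (path_elt K (special_path a (power_length a)))@_(special_path b
  (power_length b)) =
    (a == b)%:R.
  rewrite path_elt_coeff; case: (eqVneq a b) => [->|ab]; first by rewrite eqxx.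
  case: eqP => // /special_path_inj[_ h]; case/eqP: ab; apply: h.
  exact: ltnW (power_length_gt1 a).
under eq_bigr => b _ do rewrite e.
case: eqP => aV; last first.
  by rewrite big1 // => b /eqP bV; case: eqP => // ab; case: aV; rewrite ab.
rewrite (bigD1 a) ?aV ?eqxx //= big1 ?addr0 // => b /andP[_].
by rewrite eq_sym => /negPf ->.
Qed.

Lemma coeff_special_power_short a b k : (k < power_length b)%N ->
  (path_elt K (special_path a (power_length a)))@_(special_path b k) = 0.
Proof.
move=> kb; rewrite path_elt_coeff; case: eqP => // /special_path_inj[e ab].
move: kb; rewrite -e -ab ?ltnn //.
exact: ltnW (power_length_gt1 a).
Qed.

(** By minimality of the generated ideal only the relations matter. In type one the two powers
    cancel in the sum at their polygon; type two gives a special path of length L + 1; type three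
    gives a path that is not special. *)
Lemma brauer_ideal_coordinates f : brauer_ideal K G f -> coordinates_vanish f.
Proof.
apply; split; first exact: coordinates_vanish_ideal.
move=> _ [[[a [b [ab ->]]]|[a ->]]|/relations_threeE[a [b [ab nb ->]]]].
- rewrite !special_cycle_powerE; split=> [c k ck|V].
    by rewrite mcoeffB !coeff_special_power_short ?subr0.
  under eq_bigr => c _ do rewrite mcoeffB.
  by rewrite sumrB !sum_coeff_special_power ab subrr.
- have := path_elt_special K a (power_length a) 1.
  rewrite special_cycle_powerE -special_path1 iter_next_power_length => ->;
    apply: coordinates_vanish_path => c k ck.
  case/special_path_inj => e /(_ _) ac; move: ck.
  by rewrite -e ac ?addn1 ?ltnn.
rewrite path_eltM; case: path_concatP => [r _ _ _ ar|/eqP //].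
apply: coordinates_vanish_path => c k ck re.
move: ar; rewrite re /path_arrows /=; case: k {ck re} => [|[|[|k]]] //= [].
by move=> ca cb; case: nb; rewrite -ca -cb.
Qed.

Lemma path_image_eq_coordinates f g :
  quot_ring_class (brauer_ideal_ideal K G) f =
  quot_ring_class (brauer_ideal_ideal K G) g -> coordinates_vanish (f - g).
Proof. by move/quot_ring_class_eq/brauer_ideal_coordinates. Qed.

End LinearIndependence.

(** * Submodules *)

Section Submodules.
Variables (R : pzRingType) (M : lmodType R).
Implicit Types (N X Y : set M).

Lemma submodule0 N : submodule N -> N 0.
Proof. by case. Qed.

Lemma submoduleZ N a x : submodule N -> N x -> N (a *: x).
Proof. by case=> N0 NZ Nx; rewrite -[_ *: _]addr0; exact: NZ. Qed.

Lemma submoduleD N x y : submodule N -> N x -> N y -> N (x + y).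
Proof. by case=> N0 NZ Nx Ny; rewrite -[x]scale1r; exact: NZ. Qed.

Lemma submodule_sum N (I : Type) (r : seq I) (P : pred I) (F : I -> M) :
  submodule N -> (forall i, P i -> N (F i)) -> N (\sum_(i <- r | P i) F i).
Proof.
move=> hN hF; apply: (big_ind N) => //; first exact: submodule0.
by move=> x y; exact: submoduleD.
Qed.

Lemma submodule_generated_sub X N :
  submodule N -> X `<=` N -> submodule_generated X `<=` N.
Proof. by move=> hN XN x; apply. Qed.

Lemma sub_submodule_generated X : X `<=` submodule_generated X.
Proof. by move=> x Xx N [_]; apply. Qed.

Lemma sum_submodules_sub (F : set (set M)) N :
  submodule N -> (forall X, F X -> X `<=` N) -> sum_submodules F `<=` N.
Proof.
move=> hN FN; apply: submodule_generated_sub => // x [X FX Xx].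
exact: FN FX _ Xx.
Qed.

Lemma sub_sum_submodules (F : set (set M)) X : F X -> X `<=` sum_submodules F.
Proof. by move=> FX x Xx; apply: sub_submodule_generated; exists X. Qed.

Lemma sum_submodules_finite (n : nat) (U : 'I_n -> set M) :
  (forall i, submodule (U i)) ->
  sum_submodules (range U) =
  [set \sum_(i < n) u i | u in [set u : 'I_n -> M | forall i, U i (u i)]].
Proof.
move=> hU; apply/seteqP; split.
  apply: sum_submodules_sub.
    split; first by exists (fun=> 0); [move=> i;
      exact: submodule0|rewrite big1].
    move=> a _ _ [u hu <-] [w hw <-]; exists (fun i => a *: u i + w i).
      by move=> i; apply: submoduleD => //; apply: submoduleZ.
    by rewrite big_split scaler_sumr.
  move=> _ [i _ <-] x Ux; exists (fun j => if j == i then x else 0) => [j|].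
    by case: eqP => [->|_] //; exact: submodule0.
  by rewrite (bigD1 i) //= eqxx big1 ?addr0 // => j /negPf ->.
move=> _ [u hu <-]; apply: submodule_sum;
  first exact: submodule_generated_submodule.
by move=> i _; apply: (sub_sum_submodules (X := U i)) => //; exists i.
Qed.

(** Every submodule of [N 0] is a member of the chain. *)
Lemma uniserial_chain (N : nat -> set M) (n : nat) : submodule (N 0%N) ->
  N n `<=` [set 0] ->
  (forall i x, N i x ->
     N i.+1 x \/ forall X, submodule X -> X x -> N i `<=` X) ->
  uniserial (N 0%N).
Proof.
move=> hN0 Nn step; split=> // X Y hX hY XN YN.
(* Descend along the chain: if [X] or [Y] is not inside [N i.+1], it contains [N i] and hence the
   other one. At [i = n] both are zero. *)
suff h i : X `<=` N i /\ Y `<=` N i \/ (X `<=` Y \/ Y `<=` X).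
  have [[Xn _]|//] := h n; left=> x /Xn /Nn ->; exact: submodule0.
elim: i => [|i [[Xi Yi]|]]; [by left| |by right].
have [XS|/existsNP[x /not_implyP[Xx nx]]] := EM (X `<=` N i.+1); last first.
  right; right; apply: subset_trans Yi _.
  by have [|] := step i x (Xi _ Xx) => // h; exact: h.
have [YS|/existsNP[x /not_implyP[Yx nx]]] := EM (Y `<=` N i.+1); last first.
  right; left; apply: subset_trans Xi _.
  by have [|] := step i x (Yi _ Yx) => // h; exact: h.
by left.
Qed.

Lemma radical_unique_maximal (P N : set M) : maximal_submodule P N ->
  (forall X, submodule X -> X `<=` P -> X `<=` N \/ X = P) -> radical P = N.
Proof.
move=> hN uN; have [sN [NP nPN] mN] := hN.
apply/seteqP; split=> [x [_ h]|x Nx]; first exact: h hN.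
split=> [|X [sX [XP nPX] mX]]; first exact: NP.
have [XN|XE] := uN X sX XP; last by case: nPX; rewrite XE.
have [NE|NE] := mX N sN XN NP; first by rewrite -NE.
by case: nPN; rewrite NE.
Qed.

Lemma quot_module_classZ N (hN : submodule N) a x :
  quot_module_class hN (a *: x) = a *: quot_module_class hN x.
Proof. exact: esym (quot_module_scaleE hN a x). Qed.

Lemma quot_module_class_eq0 N (hN : submodule N) x :
  quot_module_class hN x = 0 <-> N x.
Proof.
have -> : 0 = quot_module_class hN 0.
  by rewrite -(scale0r (0 : M)) quot_module_classZ scale0r.
by have := quot_class_eq (submodule_subgroup hN) x 0; rewrite subr0.
Qed.

Lemma quot_module_class_sum N (hN : submodule N) n (u : 'I_n -> M) :
  quot_module_class hN (\sum_(i < n) u i) = \sum_(i < n) quot_module_class hN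
    (u i).
Proof.
apply: (big_morph (quot_module_class hN)); first exact: quot_module_classD.
exact: (quot_module_class_eq0 hN 0).2 (submodule0 hN).
Qed.

Lemma submodule_quot_image N (hN : submodule N) X :
  submodule X -> submodule (quot_module_class hN @` X).
Proof.
move=> hX; split; first by exists 0; [exact: submodule0|exact:
  (quot_module_class_eq0 hN 0).2 (submodule0 hN)].
move=> a _ _ [x Xx <-] [y Xy <-]; exists (a *: x + y); first exact: hX.2.
by rewrite quot_module_classD quot_module_classZ.
Qed.

(** Submodules of the image are compared through their preimages in [X]. *)
Lemma uniserial_quot_image N (hN : submodule N) X :
  uniserial X -> uniserial (quot_module_class hN @` X).
Proof.
move=> [hX uX]; split=> [|A B hA hB AX BX]; first exact: submodule_quot_image.
have pre (C : set (quot_module hN)) : submodule C ->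
  submodule (X `&` quot_module_class hN @^-1` C).
  move=> hC; split.
    split; first exact: submodule0.
    by rewrite /preimage /= ((quot_module_class_eq0 hN 0).2 (submodule0 hN));
      exact: hC.1.
  move=> a x y [Xx Cx] [Xy Cy]; split; first exact: hX.2.
  by rewrite /preimage /= quot_module_classD quot_module_classZ; exact: hC.2.
have [AB|BA] := uX _ _ (pre A hA) (pre B hB) (@subIsetl _ _ _) (@subIsetl _ _
  _).
  by left=> u Au; have [x Xx xu] := AX _ Au; move: Au; rewrite -xu => Ax;
    have [] := AB x (conj Xx Ax).
by right=> u Bu; have [x Xx xu] := BX _ Bu; move: Bu; rewrite -xu => Bx;
  have [] := BA x (conj Xx Bx).
Qed.

End Submodules.

(** * Paths in the Brauer configuration algebra *)

Section BrauerAlgebraPaths.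
Variables (K : fieldType) (G : brauer_configuration).
Local Notation Q := (brauer_quiver G).
Local Notation KQ := (path_algebra K Q).
Local Notation B := (brauer_algebra K G).
Implicit Types (a b c : bc_arrow G) (V : bc_polygon G) (f g w : KQ) (p q :
  qpath Q).
Local Notation next := (@next_arrow G).
Local Notation src a := (occ_polygon (val a)).
Local Notation "[ f ]" := (quot_ring_class (brauer_ideal_ideal K G) f).
Local Notation tp := (@special_path G).
Local Notation elt p := (path_elt K p).

Lemma brauer_class_eq0 f : brauer_ideal K G f <-> [f] = 0.
Proof.
have := quot_ring_class_eq (brauer_ideal_ideal K G) f 0.
have -> : [0] = 0 by rewrite -[LHS]addr0 -[X in _ + X](subrr [0]) addrA
  -quot_ring_classD addr0 subrr.
by rewrite subr0 => ->.
Qed.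

Lemma brauer_class0 : [0] = 0.
Proof. by apply/brauer_class_eq0; have [[]] := brauer_ideal_ideal K G. Qed.

Lemma brauer_class_sum (I : Type) (r : seq I) (P : pred I) (F : I -> KQ) :
  [\sum_(i <- r | P i) F i] = \sum_(i <- r | P i) [F i].
Proof.
by apply: (big_morph (quot_ring_class _));
  [exact: quot_ring_classD|exact: brauer_class0].
Qed.

(** The quotient is built as a ring, so a scalar acts through the class of its multiple of 1, on
    either side. *)
Lemma brauer_classZ (x : K) f : [x *: f] = [x *: (1 : KQ)] * [f].
Proof. by rewrite -quot_ring_classM -path_scalerAl mul1r. Qed.

Lemma brauer_classZr (x : K) f : [x *: f] = [f] * [x *: (1 : KQ)].
Proof. by rewrite -quot_ring_classM -path_scalerAr mulr1. Qed.

Lemma brauer_class_relation f :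
  (relations_one K G f \/ relations_two K G f) \/ relations_three K G f ->
  [f] = 0.
Proof. by move=> fR; apply/brauer_class_eq0 => I [_]; apply. Qed.

Lemma brauer_class_arrows_eq0 a b : b <> next a ->
  [elt (@arrow_path Q a) * elt (@arrow_path Q b)] = 0.
Proof.
move=> nb; rewrite path_eltM; case: path_concatP => [r e s _ ar|_];
  last exact: brauer_class0.
apply: brauer_class_relation; right; apply/relations_threeE.
exists a, b; split=> //; rewrite path_eltM;
  case: path_concatP => [r' _ s' _ ar'|].
  by congr path_elt; apply: qpath_eq; rewrite ?s ?ar.
by rewrite e eqxx.
Qed.

(** After L arrows the path is back at [a], so its prefix of length L + 1 is a type two relation. *)
Lemma brauer_class_special_long a k : (power_length a < k)%N ->
  path_image K (tp a k) = 0.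
Proof.
move=> ak; rewrite -(subnKC ak) addSnnS /path_image -path_elt_special.
rewrite -[(_ - _).+1]add1n -path_elt_special mulrA quot_ring_classM.
have -> : [elt (tp a (power_length a)) * elt (tp (iter (power_length a) next a)
  1)] = 0.
  apply: brauer_class_relation; left; right.
  by exists a; rewrite special_cycle_powerE special_path1
    iter_next_power_length.
by rewrite mul0r.
Qed.

Lemma path_image_special_power a b : src a = src b ->
  path_image K (tp a (power_length a)) = path_image K (tp b (power_length b)).
Proof.
move=> ab; apply/quot_ring_class_eq/brauer_class_eq0.
apply: brauer_class_relation; left; left; exists a, b; split=> //.
by rewrite !special_cycle_powerE.
Qed.

(** Induction on the length, adding an arrow [a] in front of a special path from [b]: the result is
    special if [b = next a] and contains a type three relation otherwise. Special paths longer than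
    L are zero. *)
Lemma path_image_cases p :
  path_image K p = 0 \/ exists a k, (k <= power_length a)%N /\ p = tp a k.
Proof.
suff main s V (ps : @is_path Q V s) :
    path_image K (mk_path ps) = 0 \/ exists a k, mk_path ps = tp a k.
  case: p => [[V s] ps]; have [|[a [k e]]] := main s V ps; first by left.
  have [ak|ak] := leqP k (power_length a); first by right; exists a, k.
  by left; rewrite -[LHS]/(path_image K (mk_path ps)) e;
    exact: brauer_class_special_long.
elim: s V ps => [|a s IH] V ps.
  (* A trivial path is the special path of length 0 along any arrow at [V]; one exists because [V]
     contains a nontruncated vertex. *)
  right; have [a aV] := exists_arrow_at V; exists a, 0%N.
  by rewrite special_path0; apply: qpath_eq; rewrite // -aV.
have /andP[/eqP aV ps'] := ps.
have catE : elt (mk_path ps) = elt (@arrow_path Q a) * elt (mk_path ps').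
  rewrite path_eltM; case: path_concatP => [r _ sr _ ar|/eqP[//]].
  by congr path_elt; apply: qpath_eq; rewrite ?sr ?ar //= /path_start /= -aV.
have [z|[b [k bk]]] := IH _ ps'.
  by left; move: z; rewrite /path_image catE quot_ring_classM => ->;
    rewrite mulr0.
(* If the tail has length 0, then [b] carries no information and the path is the arrow [a] alone. *)
case: k bk => [|k] bk.
  right; exists a, 1%N; apply: qpath_eq; first by rewrite /path_start /= -aV.
  by have := congr1 (@path_arrows Q) bk; rewrite /path_arrows /= => ->.
have [ba|ba] := EM (b = next a).
  right; exists a, k.+2; apply: qpath_eq; first by rewrite /path_start /= -aV.
  have := congr1 (@path_arrows Q) bk; rewrite /path_arrows /= => ->.
  by rewrite ba.
left; rewrite /path_image catE; have := path_elt_special K b 1 k.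
rewrite /= add1n -bk => e; have {e} : elt (mk_path ps') = elt (tp b 1) * elt
  (tp (next b) k) by [].
move=> ->; rewrite special_path1 mulrA quot_ring_classM brauer_class_arrows_eq0
  //.
by rewrite mul0r.
Qed.

(** One more than the largest L, so that every path of this length vanishes in the algebra. *)
Definition nilpotency_bound : nat := (\max_(a : bc_arrow G) power_length a).+1.

Lemma brauer_class_order f : order_ge nilpotency_bound f -> [f] = 0.
Proof.
elim/order_ge_ind: f /; first exact: brauer_class0.
- by move=> f g ef eg; rewrite quot_ring_classD ef eg addr0.
- by move=> x f ef; rewrite brauer_classZ ef mulr0.
move=> p pn; have [//|[a [k [ak pE]]]] := path_image_cases p.
move: pn; rewrite pE special_path_size ltnNge => /negP[].
by apply: leq_trans ak _; exact: (leq_bigmax a).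
Qed.

(** Geometric series: the element is [x] times [1 - u] with [u] nilpotent in the quotient. *)
Lemma brauer_class_right_inverse (x : K) w : x != 0 -> order_ge 1 w ->
  exists g, [x *: (1 : KQ) + w] * [g] = 1.
Proof.
move=> x0 hw; pose u : KQ := - x^-1 *: w; pose n := nilpotency_bound.
have hu : [u ^+ n] = 0.
  by apply: brauer_class_order; apply: order_geX; exact: order_geZ.
exists (x^-1 *: \sum_(i < n) u ^+ i); rewrite -quot_ring_classM -path_scalerAr.
have -> : x *: (1 : KQ) + w = x *: (1 - u).
  by rewrite scalerBr /u scalerA mulrN divff // scaleN1r opprK.
rewrite -path_scalerAl scalerA mulVf // scale1r -opprB mulNr -subrX1 opprB.
by have := quot_ring_classD (brauer_ideal_ideal K G) (1 - u ^+ n) (u ^+ n);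
  rewrite hu subrK addr0.
Qed.

(** Among the trivial paths in [g], only the one at the end of [p] survives, and it acts on [p] as
    1; [x] collects its coefficient. *)
Lemma path_elt_mul_split p g :
  exists x w, order_ge 1 w /\ elt p * g = elt p * (x *: (1 : KQ) + w).
Proof.
elim/path_algebra_ind: g => [|f g [x [w [hw e]]] [y [z [hz e']]]|c f [x [w [hw
  e]]]|q].
- exists 0, 0; split; first exact: order_ge_zero.
  by rewrite scale0r addr0.
- exists (x + y), (w + z); split; first exact: order_geD.
  by rewrite mulrDr e e' -mulrDr scalerDl addrACA.
- exists (c * x), (c *: w); split; first exact: order_geZ.
  by rewrite -path_scalerAr e path_scalerAr scalerDr scalerA.
have [q0|q0] := posnP (path_size q); last first.
  exists 0, (elt q); split; last by rewrite scale0r add0r.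
  exact: order_ge_le q0 (@order_ge_elt _ _ _).
rewrite path_eltM; case: path_concatP => [r _ s _ ar|_].
  exists 1, 0; split; first exact: order_ge_zero.
  rewrite scale1r addr0 mulr1; congr path_elt; apply: qpath_eq => //.
  by rewrite ar (size0nil q0) cats0.
exists 0, 0; split; first exact: order_ge_zero.
by rewrite scale0r addr0 mulr0.
Qed.

(** A nonzero product with a nontrivial path is again special. Since [i] is positive, its first
    arrow is [a], so it runs through the next prefix. *)
Lemma special_path_mul_radical a i w : (0 < i)%N -> order_ge 1 w ->
  exists g, [elt (tp a i) * w] = path_image K (tp a i.+1) * [g].
Proof.
move=> i0; elim/order_ge_ind: w / => [|f g [f' ef] [g' eg]|x f [f' ef]|q q0].
- by exists 0; rewrite mulr0 brauer_class0 mulr0.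
- by exists (f' + g'); rewrite mulrDr !quot_ring_classD ef eg mulrDr.
- exists (x *: f'); rewrite -path_scalerAr [LHS]brauer_classZr ef -mulrA.
  by rewrite -brauer_classZr.
rewrite path_eltM; case e: path_concat => [r|]; last first.
  by exists 0; rewrite brauer_class0 mulr0.
have [z|[c [k [_ rE]]]] := path_image_cases r.
  by exists 0; rewrite -/(path_image K r) z brauer_class0 mulr0.
move: e; rewrite rE => /path_concat_specialP; rewrite special_path_size.
move=> [ek /special_path_inj[_ /(_ i0) ac] _].
exists (elt (tp (iter i.+1 next a) (path_size q).-1)).
rewrite -quot_ring_classM path_elt_special -ac -ek.
by rewrite addSnnS prednK.
Qed.

Section RightIdeals.
Variable X : set (regular_module K G).
Hypothesis hX : submodule X.

Lemma right_ideal0 : X (0 : B).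
Proof. exact: hX.1. Qed.

Lemma right_idealD (x y : B) : X x -> X y -> X (x + y : B).
Proof. exact: (submoduleD hX). Qed.

Lemma right_idealM (x y : B) : X x -> X (x * y : B).
Proof. by move=> Xx; have := submoduleZ (y : B^c) hX Xx. Qed.

End RightIdeals.

(** The analogue at length 0: the first arrow can now be any arrow at [V], so [X] has to contain all
    of them. *)
Lemma trivial_path_mul_radical V w (X : set (regular_module K G)) :
  submodule X -> (forall a, src a = V -> X (path_image K (tp a 1) :
    regular_module K G)) ->
  order_ge 1 w -> X ([elt (@trivial_path Q V) * w] : regular_module K G).
Proof.
move=> hX XV; elim/order_ge_ind: w / => [|f g Xf Xg|x f Xf|q q0].
- by rewrite mulr0 brauer_class0; exact: (right_ideal0 hX).
- by rewrite mulrDr quot_ring_classD; exact: right_idealD.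
- by rewrite -path_scalerAr brauer_classZr; exact: right_idealM.
rewrite path_eltM; case: path_concatP => [r _ s _ ar|_]; last first.
  by rewrite brauer_class0; exact: hX.1.
have [z|[a [k [_ rE]]]] := path_image_cases r.
  by rewrite -/(path_image K r) z; exact: hX.1.
have k0 : (0 < k)%N.
  by rewrite -(special_path_size a k) -rE /path_size ar.
have aV : src a = V by move: s; rewrite rE.
rewrite rE -(prednK k0) -add1n -path_elt_special quot_ring_classM.
exact: (right_idealM hX _ (XV a aV)).
Qed.

End BrauerAlgebraPaths.

(** * Indecomposable projective modules *)

Section ProjectiveModules.
Variables (K : fieldType) (G : brauer_configuration).
Local Notation Q := (brauer_quiver G).
Local Notation KQ := (path_algebra K Q).
Local Notation B := (brauer_algebra K G).
Local Notation M := (regular_module K G).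
Implicit Types (a b c : bc_arrow G) (V : bc_polygon G) (f g w : KQ) (p q :
  qpath Q).
Implicit Types (X Y : set M).
Local Notation next := (@next_arrow G).
Local Notation src a := (occ_polygon (val a)).
Local Notation "[ f ]" := (quot_ring_class (brauer_ideal_ideal K G) f).
Local Notation tp := (@special_path G).
Local Notation elt p := (path_elt K p).

(** * Right ideals generated by special paths, and uniseriality of $U_1(C)$ *)

Definition cyclic_module (x : B) : set M := [set x * y | y in [set: B]].

Definition special_module a k : set M := cyclic_module (path_image K (tp a k)).

Lemma cyclic_submodule (x : B) : submodule (cyclic_module x).
Proof.
split; first by exists 0; rewrite ?mulr0.
move=> z _ _ [y _ <-] [y' _ <-]; exists (y * (z : B) + y') => //.
by rewrite mulrDr mulrA.
Qed.

Lemma cyclic_module_id (x : B) : cyclic_module x x.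
Proof. by exists 1; rewrite ?mulr1. Qed.

Lemma cyclic_module_sub (x : B) X : submodule X -> X x ->
  cyclic_module x `<=` X.
Proof. by move=> hX Xx _ [y _ <-]; exact: right_idealM. Qed.

Lemma submodule_generated1 (x : B) :
  submodule_generated [set (x : M)] = cyclic_module x.
Proof.
apply/seteqP; split.
  apply: submodule_generated_sub; first exact: cyclic_submodule.
  by move=> _ ->; exact: cyclic_module_id.
apply: cyclic_module_sub; first exact: submodule_generated_submodule.
exact: (sub_submodule_generated (X := [set (x : M)])).
Qed.

Lemma cyclic_path_split p x : cyclic_module (path_image K p) x ->
  (exists2 w, order_ge 1 w & x = [elt p * w]) \/
  (forall X, submodule X -> X x -> cyclic_module (path_image K p) `<=` X).
Proof.
move=> [y _ <-{x}]; have [g <-{y}] := quot_ring_class_surj y.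
have [c [w [hw e]]] := path_elt_mul_split p g.
rewrite -quot_ring_classM e; have [c0|c0] := eqVneq c 0.
  by left; exists w => //; rewrite c0 scale0r add0r.
right=> X hX Xx; apply: cyclic_module_sub => //.
have [h hE] := brauer_class_right_inverse c0 hw.
have := right_idealM hX [h] Xx.
by rewrite quot_ring_classM -mulrA hE mulr1.
Qed.

Lemma special_module_chain a i x : (0 < i)%N -> special_module a i x ->
  special_module a i.+1 x \/
  (forall X, submodule X -> X x -> special_module a i `<=` X).
Proof.
move=> i0 /cyclic_path_split[[w hw ->]|]; last by right.
by left; have [g ->] := special_path_mul_radical a i0 hw; exists [g].
Qed.

Lemma special_module_long a k : (power_length a < k)%N ->
  special_module a k `<=` [set 0].
Proof.
by move=> ak _ [y _ <-]; rewrite brauer_class_special_long // mul0r.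
Qed.

Lemma special_module_le a k l : (k <= l)%N ->
  special_module a l `<=` special_module a k.
Proof.
move=> kl; apply: cyclic_module_sub; first exact: cyclic_submodule.
exists [elt (tp (iter k next a) (l - k))] => //.
by rewrite -quot_ring_classM path_elt_special subnKC.
Qed.

Lemma special_module_uniserial a : uniserial (special_module a 1).
Proof.
(* The index is shifted by one: the member at [i = power_length a] is generated by a path of length
   L + 1, hence is zero. *)
apply: (@uniserial_chain _ _ (fun i => special_module a i.+1) (power_length a)).
- exact: cyclic_submodule.
- exact: special_module_long.
by move=> i x; exact: special_module_chain.
Qed.

Lemma first_arrow_moduleE a :
  first_arrow_module K (special_cycle a) = special_module a 1.
Proof.
rewrite /first_arrow_module submodule_generated1;
  congr (cyclic_module (path_image K _)).
apply: qpath_eq => //; rewrite /path_arrows /=.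
by rewrite take_traject // valency_gt0.
Qed.

Lemma path_image_special_power_neq0 a : path_image K (tp a (power_length a)) <>
  0.
Proof.
rewrite -(brauer_class0 K G) => /path_image_eq_coordinates[_ /(_ (src a))].
under eq_bigr => b _ do rewrite subr0.
by rewrite sum_coeff_special_power eqxx => /eqP; rewrite oner_eq0.
Qed.

Lemma special_module_sub_projective a k : special_module a k `<=`
  projective_module K (src a).
Proof.
by have := @special_module_le a 0 k (leq0n k);
  rewrite /special_module special_path0.
Qed.

(** * The radical of $P$ *)

Definition nontrivial_module V : set M :=
  sum_submodules [set special_module a 1 | a in [set a | src a = V]].

Lemma nontrivial_module_submodule V : submodule (nontrivial_module V).
Proof. exact: submodule_generated_submodule. Qed.

Lemma special_module_sub_nontrivial a : special_module a 1 `<=`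
  nontrivial_module (src a).
Proof. by apply: sub_sum_submodules; exists a. Qed.

Lemma nontrivial_module_sub V : nontrivial_module V `<=` projective_module K V.
Proof.
apply: sum_submodules_sub; first exact: cyclic_submodule.
by move=> _ [a <- <-]; exact: special_module_sub_projective.
Qed.

Lemma projective_module_split V x : projective_module K V x ->
  nontrivial_module V x \/
  (forall X, submodule X -> X x -> projective_module K V `<=` X).
Proof.
move=> /cyclic_path_split[[w hw ->]|]; last by right.
left; apply: trivial_path_mul_radical hw;
  first exact: nontrivial_module_submodule.
by move=> a <-; apply: special_module_sub_nontrivial; exact: cyclic_module_id.
Qed.

(** The classes of elements of the arrow ideal form a right ideal containing all arrows. This serves
    to keep $e_v$ out of the sum of the $U_1(C)$. *)
Lemma nontrivial_module_order V : nontrivial_module V `<=`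
  [set x : M | exists2 f, order_ge 1 f & x = [f]].
Proof.
have hX : submodule [set x : M | exists2 f, order_ge 1 f & x = [f]].
  split; first by exists 0; [exact: order_ge_zero|rewrite brauer_class0].
  move=> y _ _ [f hf ->] [g hg ->]; have [h hE] := quot_ring_class_surj (y : B).
  exists (f * h + g); last by rewrite quot_ring_classD quot_ring_classM hE.
  by apply: order_geD => //; rewrite -[1%N]addn0; apply: order_geM.
apply: sum_submodules_sub => // _ [a _ <-]; apply: cyclic_module_sub => //.
by exists (elt (tp a 1)) => //; exact: (@order_ge_elt K _ (tp a 1)).
Qed.

(** The coordinate at length 0 is 1 on $e_v$ and 0 on the arrow ideal. *)
Lemma trivial_path_not_nontrivial V :
  ~ nontrivial_module V (path_image K (@trivial_path Q V)).
Proof.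
have [a <-] := exists_arrow_at V.
move=> /nontrivial_module_order[f hf /path_image_eq_coordinates[h _]].
have := h a 0%N (ltnW (power_length_gt1 a)).
rewrite -special_path0 mcoeffB path_elt_coeff eqxx hf ?special_path_size //.
by move/eqP; rewrite subr0 oner_eq0.
Qed.

(** An element of $P$ outside the sum of the $U_1(C)$ generates $P$, so this sum, which misses
    $e_v$, contains every proper submodule. *)
Lemma radical_projective V : radical (projective_module K V) =
  nontrivial_module V.
Proof.
have unique X : submodule X -> X `<=` projective_module K V ->
    X `<=` nontrivial_module V \/ X = projective_module K V.
  move=> hX XP; have [XN|] := EM (X `<=` nontrivial_module V); first by left.
  move=> /existsNP[x /not_implyP[Xx nx]]; right.
  have [//|h] := projective_module_split (XP _ Xx).
  by apply/seteqP; split=> //; exact: h.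
apply: radical_unique_maximal => //; split;
  first exact: nontrivial_module_submodule.
  split; first exact: nontrivial_module_sub.
  by move/(_ _ (cyclic_module_id _)); exact: trivial_path_not_nontrivial.
move=> X hX NX XP; have [XN|] := unique X hX XP; last by right.
by left; apply/seteqP.
Qed.

(** * The socle of $P$ and the intersections of the $U_1(C)$ *)

Lemma coeff_path_mul_start p g q : path_start q <> path_start p ->
  (elt p * g)@_q = 0.
Proof.
move=> qp; apply: coeff_mul_pathl0 => s; case: path_concatP => // r _ sr _ _
  [rq].
by case: qp; rewrite -rq.
Qed.

Lemma special_module_power a b : src a = src b ->
  special_module a (power_length a) = special_module b (power_length b).
Proof. by move=> ab; rewrite /special_module (path_image_special_power K ab).
  Qed.

(** The only paths in the support of [f] with nonzero image are full powers starting at the polygon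
    of [a], and these all have the same image. *)
Lemma power_module_of_coordinates a f :
  (forall p, path_start p <> src a -> f@_p = 0) ->
  (forall c k, (k < power_length c)%N -> f@_(tp c k) = 0) ->
  special_module a (power_length a) [f].
Proof.
move=> fa fc; have hS := cyclic_submodule (path_image K (tp a (power_length
  a))).
rewrite [f]path_algebra_suppE brauer_class_sum.
apply: (submodule_sum (N := special_module a (power_length a))) => // p _.
rewrite brauer_classZr -/(path_image K p).
have [->|[c [k [ck pE]]]] := path_image_cases K p.
  by rewrite mul0r; exact: hS.1.
have [cE|ca] := EM (src c = src a); last first.
  by rewrite fa ?scale0r ?brauer_class0 ?mulr0; [exact: hS.1|rewrite pE].
move: ck; rewrite leq_eqVlt => /orP[/eqP kE|ck]; last first.
  by rewrite pE fc // scale0r brauer_class0 mulr0; exact: hS.1.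
by rewrite pE kE (path_image_special_power K cE);
  exists [f@_(tp c (power_length c)) *: (1 : KQ)].
Qed.

Lemma projective_annihilated a x : projective_module K (src a) x ->
  (forall b, (x : B) * path_image K (tp b 1) = 0) ->
  special_module a (power_length a) x.
Proof.
move=> [y _ <-{x}]; have [g <-{y}] := quot_ring_class_surj y.
rewrite -quot_ring_classM; set f := _ * g => fb.
apply: power_module_of_coordinates => [p pa|c k ck].
  exact: coeff_path_mul_start.
(* Multiplying by the arrow that continues the special path moves the coefficient of [f] at length
   [k] to length [k + 1]. *)
have := fb (iter k next c); rewrite -quot_ring_classM -(brauer_class0 K G).
move=> /path_image_eq_coordinates; rewrite subr0 => -[h1 h2].
have e := path_concat_special c k 1.
have [k1|k1] := ltnP (k + 1) (power_length c).
  by rewrite -(coeff_mul_pathr f e) h1.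
have {k1} kE : (k + 1 = power_length c)%N by apply/eqP;
  rewrite eqn_leq k1 addn1 ck.
(* At length L only the sum over the powers at [src c] is known to vanish. A power with the same
   last arrow as that of [c] has the same first arrow, so the sum reduces to the term of [c]. *)
rewrite -(coeff_mul_pathr f e) kE -[RHS](h2 (src c)) (bigD1 c) //= big1 ?addr0
  //.
move=> d /andP[_ dc]; apply: coeff_mul_pathr0 => p /path_concat_specialP.
rewrite special_path_size => -[pd _ /special_path_inj[_ /(_ isT) pe]].
case/eqP: dc; rewrite -(iter_next_power_length d) -pd addn1 iterS -pe.
by rewrite -iterS -addn1 kE iter_next_power_length.
Qed.

(** Induction on a length [n] whose paths all kill [x]: if some arrow does not kill [x], the product
    with it is killed by all paths one shorter. *)
Lemma exists_annihilated V X x n : submodule X -> X x ->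
  projective_module K V x ->
  x <> 0 -> (forall p, path_size p = n -> (x : B) * path_image K p = 0) ->
  exists y, [/\ X y, projective_module K V y, y <> 0 &
    forall b, (y : B) * path_image K (tp b 1) = 0].
Proof.
move=> hX; elim: n x => [|n IH] x Xx Px x0 xn.
  (* At length 0 all trivial paths kill [x]; they sum to 1, so [x] would be zero. *)
  case: x0; rewrite -[x](mulr1 (x : B)).
  have -> : 1 = \sum_V path_image K (@trivial_path Q V) :> B.
    by rewrite /path_image -brauer_class_sum.
  by rewrite mulr_sumr big1 // => W _; apply: xn.
have [h|/existsNP[b xb]] := EM (forall b, (x : B) * path_image K (tp b 1) = 0).
  by exists x.
apply: (IH ((x : B) * path_image K (tp b 1))) => //.
- exact: right_idealM.
- by apply: right_idealM => //; exact: cyclic_submodule.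
move=> p pn; rewrite -mulrA -quot_ring_classM path_eltM.
case: path_concatP => [r _ _ _ ar|_]; last by rewrite brauer_class0 mulr0.
by apply: xn; rewrite /path_size ar size_cat -/(path_size p) pn.
Qed.

Lemma power_module_essential a X x : submodule X -> X x ->
  projective_module K (src a) x -> x <> 0 ->
  special_module a (power_length a) `<=` X.
Proof.
move=> hX Xx Px x0.
have [|y [Xy Py y0 yb]] := @exists_annihilated _ X x (nilpotency_bound G) hX Xx
  Px x0.
  move=> p pn; rewrite /path_image brauer_class_order ?mulr0 // -pn.
  exact: order_ge_elt.
(* At the last step of the chain the next module is zero, so the nonzero [y] generates the whole
   power module. *)
have [||/(special_module_long (leqnn _)) //|h] :=
  @special_module_chain a (power_length a) y.
- exact: ltnW (power_length_gt1 a).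
- exact: projective_annihilated.
exact: h.
Qed.

Lemma power_module_simple a : simple_submodule (special_module a (power_length
  a)).
Proof.
split; first exact: cyclic_submodule.
  move=> e; apply: (@path_image_special_power_neq0 a).
  by have := cyclic_module_id (path_image K (tp a (power_length a)));
    rewrite -/(special_module _ _) e.
move=> X hX XS; have [X0|/existsNP[x /not_implyP[Xx x0]]] :=
  EM (X `<=` [set 0]).
  left; apply/seteqP; split=> // _ ->; exact: hX.1.
right; apply/seteqP; split=> //; apply: (power_module_essential hX Xx _ x0).
exact: (special_module_sub_projective (XS _ Xx)).
Qed.

Lemma socle_projective a V : src a = V ->
  socle (projective_module K V) = special_module a (power_length a).
Proof.
move=> <-{V}; apply/seteqP; split.
  apply: sum_submodules_sub; first exact: cyclic_submodule.
  move=> X [[hX X0 mX] XP].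
  have [X0'|/existsNP[x /not_implyP[Xx x0]]] := EM (X `<=` [set 0]).
    by case: X0; apply/seteqP; split=> // _ ->; exact: hX.1.
  have SX := power_module_essential hX Xx (XP _ Xx) x0.
  have [S0|<- //] := mX _ (cyclic_submodule _) SX.
  have [_ S0' _] := power_module_simple a; by case: S0'.
apply: sub_sum_submodules; split; first exact: power_module_simple.
exact: special_module_sub_projective.
Qed.

(** A representative beginning with [a] has no coordinate along other arrows, and below L its
    coordinates along [a] are those of [h]. Both the intersections and the directness of the heart
    reduce to this. *)
Lemma special_module_independent a x h : special_module a 1 x -> x = [h] ->
  (forall k, (k < power_length a)%N -> h@_(tp a k) = 0) ->
  special_module a (power_length a) x.
Proof.
move=> [y _ <-{x}]; have [g <-{y}] := quot_ring_class_surj y.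
rewrite -quot_ring_classM => /path_image_eq_coordinates[fh _] ha.
apply: power_module_of_coordinates => [p pa|c k ck].
  exact: coeff_path_mul_start.
have [ca|ca] := eqVneq c a.
  move: ck; rewrite ca => ck.
  by have := fh a k ck; rewrite mcoeffB ha // subr0.
apply: coeff_mul_pathl0 => p /path_concat_specialP[_].
rewrite special_path_size => /special_path_inj[_ /(_ isT) ac].
by rewrite ac eqxx in ca.
Qed.

Lemma coeff_special_mul a b g k : a != b -> (elt (tp b 1) * g)@_(tp a k) = 0.
Proof.
move=> ab; apply: coeff_mul_pathl0 => p /path_concat_specialP[_].
rewrite special_path_size => /special_path_inj[_ /(_ isT) ba].
by rewrite ba eqxx in ab.
Qed.

Lemma special_moduleP a k x : special_module a k x ->
  exists g, x = [elt (tp a k) * g].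
Proof.
move=> [y _ <-]; have [g <-] := quot_ring_class_surj y.
by exists g; rewrite quot_ring_classM.
Qed.

Lemma special_module_setI a b : src a = src b -> a != b ->
  special_module a 1 `&` special_module b 1 = special_module a (power_length a).
Proof.
move=> ab nab; apply/seteqP; split=> [x [xa xb]|x xs].
  have [g xE] := special_moduleP xb.
  (* The representative [g] gives begins with [b], so all its coordinates along [a] vanish. *)
  by apply: special_module_independent xa xE _ => k _; exact: coeff_special_mul.
split; first by apply: special_module_le xs; exact: ltnW (power_length_gt1 a).
move: xs; rewrite (special_module_power ab).
by apply: special_module_le; exact: ltnW (power_length_gt1 b).
Qed.

End ProjectiveModules.

Arguments special_module K {G} a k.
Arguments nontrivial_module K {G} V.

(** * The heart *)

Section Heart.
Variables (K : fieldType) (G : brauer_configuration) (V : bc_polygon G).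
Local Notation Q := (brauer_quiver G).
Local Notation B := (brauer_algebra K G).
Local Notation src a := (occ_polygon (val a)).
Local Notation "[ f ]" := (quot_ring_class (brauer_ideal_ideal K G) f).
Local Notation tp := (@special_path G).
Local Notation elt p := (path_elt K p).
Local Notation arrows_at_V := [pred a : bc_arrow G | src a == V].

Lemma special_cycle_inj : injective (@special_cycle G).
Proof.
move=> a b /(congr1 (@path_arrows _)); rewrite /path_arrows /=.
by have := valency_gt0 a; have := valency_gt0 b;
  do 2!case: (valency _ _) => // ? _; case.
Qed.

Lemma card_special_cycles_at :
  #|` special_cycles_at V| = count (predC (@truncated G)) (bc_content V).
Proof.
rewrite -card_arrows_at /special_cycles_at card_imfset;
  last exact: special_cycle_inj.
rewrite cardE; apply/perm_size/uniq_perm;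
  rewrite ?enum_finmem_uniq ?enum_uniq // => a.
by rewrite enum_finmemE mem_enum.
Qed.

Lemma special_cycles_atP C :
  reflect (exists2 a, src a = V & C = special_cycle a) (C \in special_cycles_at
    V).
Proof.
apply: (iffP idP) => [/imfsetP[a /eqP aV ->]|[a aV ->]]; first by exists a.
by apply/imfsetP; exists a => //; exact/eqP.
Qed.

Lemma src_arrow_at (i : 'I_#|arrows_at_V|) : src (enum_val i) = V.
Proof. exact/eqP/(enum_valP i). Qed.

Lemma nontrivial_module_range :
  nontrivial_module K V = sum_submodules (range (fun i :
    'I_#|arrows_at_V| => special_module K (enum_val i) 1)).
Proof.
congr sum_submodules; apply/seteqP; split=> [_ [a aV <-]|_ [i _ <-]].
  have aA : a \in [pred a : bc_arrow G | src a == V] by rewrite inE; apply/eqP.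
  by exists (enum_rank_in aA a) => //; rewrite enum_rankK_in.
by exists (enum_val i) => //; exact: src_arrow_at.
Qed.

(** [x i] is the total, represented in length at least L along its arrow, minus the other terms,
    which begin with other arrows. So it has a representative without coordinates below L along its
    own arrow. *)
Lemma power_module_of_sum (x : 'I_#|arrows_at_V| -> regular_module K G) i :
  (forall j, special_module K (enum_val j) 1 (x j)) ->
  socle (projective_module K V) (\sum_j x j) ->
  socle (projective_module K V) (x i).
Proof.
move=> hx; rewrite (socle_projective K (src_arrow_at i)) => /special_moduleP[g0
  xg0].
have /choice[g xg] j := special_moduleP (hx j).
pose h := elt (tp (enum_val i) (power_length (enum_val i))) * g0 -
  \sum_(j | j != i) elt (tp (enum_val j) 1) * g j.
apply: (special_module_independent (h := h)) => [//||k ki].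
  have hE := quot_ring_classD (brauer_ideal_ideal K G) h
    (\sum_(j | j != i) elt (tp (enum_val j) 1) * g j).
  have sE : [\sum_(j | j != i) elt (tp (enum_val j) 1) * g j] = \sum_(j | j !=
    i) x j.
    by rewrite brauer_class_sum; apply: eq_bigr => j _; rewrite xg.
  rewrite subrK -xg0 (bigD1 i) //= sE in hE.
  exact: addIr hE.
rewrite mcoeffB (big_morph (mcoeff _) (mcoeffD _) (mcoeff0 _)) big1 => [|j ji].
  rewrite subr0; apply: coeff_mul_pathl0 => p /path_concat_specialP[].
  by rewrite special_path_size => e; move: ki; rewrite -e ltnNge leq_addr.
apply: coeff_special_mul; apply: contraNneq ji => /enum_val_inj ->.
by [].
Qed.

Definition heart_summand (i : 'I_#|arrows_at_V|) :=
  quot_module_class (socle_submodule (projective_module K V)) @`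
    special_module K (enum_val i) 1.

(** A relation between the summands lifts to elements of the $U_1(C)$ whose sum is in the socle; by
    [power_module_of_sum] each of them is then in the socle. *)
Lemma heart_direct_sum : direct_sum heart_summand (heart (projective_module K
  V)).
Proof.
set hS := socle_submodule (projective_module K V).
have lift (u : 'I_#|arrows_at_V| -> quot_module hS) :
    (forall i, heart_summand i (u i)) ->
    exists2 x, forall i, special_module K (enum_val i) 1 (x i) &
      forall i, quot_module_class hS (x i) = u i.
  move=> hu; have /choice[x hx] i :
      exists y, special_module K (enum_val i) 1 y /\ quot_module_class hS y = u
        i.
    by have [y yU yu] := hu i; exists y.
  by exists x => i; have [] := hx i.
split=> [i||u hu u0 i].
- apply: submodule_quot_image; exact: cyclic_submodule.
- rewrite /heart radical_projective nontrivial_module_range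
    sum_submodules_finite => [|i]; last exact: cyclic_submodule.
  apply/seteqP; split=> [_ [_ [x hx <-] <-]|_ [u hu <-]].
    exists (fun i => quot_module_class hS (x i));
      last by rewrite quot_module_class_sum.
    by move=> i; exists (x i).
  have [x hx xu] := lift u hu; exists (\sum_i x i); first by exists x.
  by rewrite quot_module_class_sum; apply: eq_bigr => i _.
have [x hx xu] := lift u hu.
rewrite -xu; apply/(quot_module_class_eq0 hS); apply: power_module_of_sum => //.
apply/(quot_module_class_eq0 hS); rewrite quot_module_class_sum -[RHS]u0.
by apply: eq_bigr => j _; exact: xu.
Qed.

End Heart.

(** * Radical, intersections and heart of $P$ together *)

Theorem theorem3p10 (K : fieldType) (G : brauer_configuration)
  (G_reduced : reduced G) (V : bc_polygon G) (d r : nat)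
  (V_dgon : size (bc_content V) = d)
  (r_nontruncated : no_truncated_vertex V -> r = d)
  (r_truncated : two_gon_with_one_truncated V -> r = 1%N) :
  let P := projective_module K V in
  let U1 := @first_arrow_module K G in
  [/\ #|` special_cycles_at V| = r,
      forall C, C \in special_cycles_at V -> uniserial (U1 C),
      radical P = sum_submodules [set U1 C | C in [set` special_cycles_at V]],
      (1 < r)%N -> forall C C', C \in special_cycles_at V ->
        C' \in special_cycles_at V -> C != C' ->
        U1 C `&` U1 C' = socle P /\ simple_submodule (socle P) &
      exists (n : nat) (W : 'I_n -> set (quot_module (socle_submodule P))),
        direct_sum W (heart P) /\ forall i, uniserial (W i)].
Proof.
move=> P U1; split.
- rewrite card_special_cycles_at.
  have cE := count_predC (@truncated G) (bc_content V).
  (* Special cycles at [V] are counted by nontruncated occurrences: all [d] of them in the first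
     case, one of two in the second. *)
  have [nt|tr] := G_reduced V.
    rewrite (r_nontruncated nt) -V_dgon -cE;
      have -> // : count (@truncated G) (bc_content V) = 0%N.
    apply/eqP; rewrite -[_ == _]negbK -lt0n -has_count; apply/hasPn => x xV.
    by have /implyP := forallP nt x; apply.
  rewrite (r_truncated tr); case/andP: tr => /eqP s2 /eqP c1.
  by move: cE; rewrite s2 c1 add1n => -[].
- by move=> _ /special_cycles_atP[a _ ->]; rewrite /U1 first_arrow_moduleE;
    exact: special_module_uniserial.
- rewrite /P radical_projective; congr sum_submodules; apply/seteqP; split.
    move=> _ [a aV <-]; exists (special_cycle a);
      last by rewrite /U1 first_arrow_moduleE.
    by apply/special_cycles_atP; exists a.
  by move=> _ [_ /special_cycles_atP[a aV ->] <-]; exists a;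
    rewrite // /U1 first_arrow_moduleE.
- move=> _ _ _ /special_cycles_atP[a aV ->] /special_cycles_atP[b bV ->] ab.
  rewrite /U1 /P !first_arrow_moduleE (socle_projective K aV); split;
    last exact: power_module_simple.
  apply: special_module_setI; first by rewrite aV.
  by apply: contraNneq ab => ->.
- exists _, (@heart_summand K G V); split; first exact: heart_direct_sum.
  by move=> i; apply: uniserial_quot_image; exact: special_module_uniserial.
Qed.
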